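(* Let $J\subset\mathbb R$ be a compact interval with nonempty interior and $\varepsilon>0$. The six-problem ambient $$\mathcal U^\sharp_{2,J,\varepsilon}=\{\mathcal P^\sigma_{J,\mathrm{diag}},\mathcal P^\sigma_{J,\mathrm{gen}},\mathcal P^\sigma_{J,\mathrm{graph}},\mathcal P^{\sigma_\varepsilon}_{J,\varepsilon,\mathrm{diag}},\mathcal P^{\sigma_\varepsilon}_{J,\varepsilon,\mathrm{gen}},\mathcal P^{\sigma_\varepsilon}_{J,\varepsilon,\mathrm{graph}}\}$$ is raw-principal at height $2$, that is, $$\operatorname{MinDeg}^{\mathrm{raw}}_2(\mathcal U^\sharp_{2,J,\varepsilon})=\{[\mathcal P^\sigma_{J,\mathrm{diag}}]_{\mathrm{raw}}\}=\{[\mathcal P^{\sigma_\varepsilon}_{J,\varepsilon,\mathrm{diag}}]_{\mathrm{raw}}\}.$$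
   Context: $\mathbb N=\{1,2,\dots\}$, $\mathbb N_0=\{0,1,2,\dots\}$. SCI computational problem: $\mathcal P=(\Xi,\Omega,(\mathcal M,d),\Lambda)$ with $\Omega$ a set, $(\mathcal M,d)$ a metric space, $\Xi:\Omega\to\mathcal M$, and $\Lambda$ a set of functions $\Omega\to\mathbb C$ such that $\Xi(A)\neq\Xi(B)$ implies $f(A)\neq f(B)$ for some $f\in\Lambda$. General algorithm: a pair $(\Gamma,\Lambda_\Gamma)$, $\Gamma:\Omega\to\mathcal M$, $\Lambda_\Gamma:\Omega\to\{\text{finite subsets of }\Lambda\}$, such that if $f(B)=f(A)$ for all $f\in\Lambda_\Gamma(A)$, then $\Gamma(B)=\Gamma(A)$ and $\Lambda_\Gamma(B)=\Lambda_\Gamma(A)$. A raw type-G tower of height $0$ is a general algorithm with $\Gamma=\Xi$; one of height $k\ge1$ is a family of general algorithms $\Gamma_{n_k,\dots,n_1}$ with $\Xi(A)=\lim_{n_k\to\infty}\cdots\lim_{n_1\to\infty}\Gamma_{n_k,\dots,n_1}(A)$ for all $A$ (all successive limits existing). $\operatorname{SCI}_{\mathrm G}(\mathcal P)$ is the least $k\in\mathbb N_0$ for which a tower of height $k$ exists ($\infty$ if none). Raw finite-query reduction: $\mathcal S=(\Psi,\Sigma,(\mathcal N,\rho),\Lambda_{\mathcal S})\le_{\mathrm{raw},\mathrm{fq}}\mathcal P=(\Xi,\Omega,(\mathcal M,d),\Lambda_{\mathcal P})$ if there are an arbitrary map $E:\Sigma\to\Omega$, a continuous map $D:\mathcal M\to\mathcal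 N$, and for every $f\in\Lambda_{\mathcal P}$ some $m_f\in\mathbb N_0$, $\gamma_{f,1},\dots,\gamma_{f,m_f}\in\Lambda_{\mathcal S}$ and an arbitrary map $\vartheta_f$ from the joint image $\{(\gamma_{f,1}(A),\dots,\gamma_{f,m_f}(A)):A\in\Sigma\}$ (a one-point set if $m_f=0$) to $\operatorname{im}(f)$, such that for all $A\in\Sigma$, $D(\Xi(E(A)))=\Psi(A)$ and $f(E(A))=\vartheta_f(\gamma_{f,1}(A),\dots,\gamma_{f,m_f}(A))$ for all $f\in\Lambda_{\mathcal P}$. Degrees: $\mathcal O_k(\mathcal U)=\{\mathcal P\in\mathcal U:\operatorname{SCI}_{\mathrm G}(\mathcal P)=k\}$; $\equiv_{\mathrm{raw},\mathrm{fq}}$ is mutual reducibility; $D^{\mathrm{raw}}_k(\mathcal U)=\mathcal O_k(\mathcal U)/\equiv_{\mathrm{raw},\mathrm{fq}}$ with classes $[\mathcal P]_{\mathrm{raw}}$ ordered by $[\mathcal P]_{\mathrm{raw}}\preceq[\mathcal Q]_{\mathrm{raw}}$ iff $\mathcal P\le_{\mathrm{raw},\mathrm{fq}}\mathcal Q$; $\operatorname{MinDeg}^{\mathrm{raw}}_k(\mathcal U)$ is the set of minimal elements of $D^{\mathrm{raw}}_k(\mathcal U)$. Windows: $\mathcal K_{\mathrm{sgl}}(J)=\{\{z\}:z\in J\}$; for each $K=\{z\}$ fix $r_n(K)\in\mathbb Q+i\mathbb Q$ with $|r_n(K)-z|\le2^{-(n+1)}$, $n\in\mathbb N$. Operator instance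 classes. (diag) $\Omega_{\mathrm{diag}}$: maximal diagonal operators on $\ell^2(\mathbb N)$, $Ae_j=a_je_j$ with $(a_j)\subset\mathbb C$ arbitrary, $\mathcal D(A)=\{x:(a_jx_j)_j\in\ell^2(\mathbb N)\}$. (gen) $\Omega_{\mathrm{gen}}$: instances are closed densely defined operators $A$ on $\ell^2(\mathbb N)$ such that $\operatorname{span}\{e_n\}$ is a core of $A$ and of $A^*$, together with witness data of bounded dispersion: $f:\mathbb N\to\mathbb N$ and a null sequence $(c_n)$ of nonnegative rationals with $D_{f,n}(A)=\max\{\|(I-P_{f(n)})AP_n\|,\|(I-P_{f(n)})A^*P_n\|\}\le c_n$, where $P_n$ is the orthogonal projection onto $\operatorname{span}\{e_1,\dots,e_n\}$. (graph) Fix a connected countable graph with vertex set $V=\{v_1,v_2,\dots\}$. $\Omega_{\mathrm{graph}}$: closed densely defined operators $A$ on $\ell^2(V)$ such that $\operatorname{span}\{\mathbf 1_v\}$ is a core of $A$ and $A^*$, with coefficients $\alpha_A(v,w)=\langle A\mathbf 1_w,\mathbf 1_v\rangle$, together with finite sets $S_v\subset V$ such that $\alpha_A(v,w)=\alpha_A(w,v)=0$ for $w\notin S_v$. Interfaces (on $\Omega_\star\times\mathcal K_{\mathrm{sgl}}(J)$), all containing $\rho_n=r_n(K)$, $n\in\mathbb N$: diag additionally has $\mu_j=a_j$; gen additionally has the matrix entries $m_{ij}=\langle Ae_j,e_i\rangle$ and the values $f(n)$, $c_n$; graph additionally has $\alpha_{ij}=\alpha_A(v_i,v_j)$ and the finite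 sets $S_{v_i}$ (coded as natural numbers by a fixed injective coding). Pseudospectrum: $\sigma_\varepsilon(A)=\overline{\{z\in\mathbb C:\|(A-zI)^{-1}\|>\varepsilon^{-1}\}}$ (norm $=\infty$ on $\sigma(A)$). For $\star\in\{\mathrm{diag},\mathrm{gen},\mathrm{graph}\}$, $\mathcal P^\sigma_{J,\star}$ has instance set $\Omega_\star\times\mathcal K_{\mathrm{sgl}}(J)$, the corresponding interface, output space $\{0,1\}$ with the discrete metric and target $1$ if $\sigma(A)\cap K=\varnothing$, $0$ otherwise; $\mathcal P^{\sigma_\varepsilon}_{J,\varepsilon,\star}$ is the same with target $1$ if $\sigma_\varepsilon(A)\cap K=\varnothing$, $0$ otherwise. *)

(* Defs.v *)
From HB Require Import structures.
From mathcomp Require Import all_boot all_order all_algebra finmap.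
From mathcomp Require Import all_classical all_reals all_analysis.
From mathcomp Require Import complex ring lra.

Set Implicit Arguments.
Unset Strict Implicit.
Unset Printing Implicit Defensive.

Import Order.TTheory GRing.Theory Num.Theory.
Import numFieldNormedType.Exports.

Local Open Scope classical_set_scope.
Local Open Scope ring_scope.
Local Open Scope complex_scope.

(* The positive integers {1, 2, ...} are represented by nat through n |-> n.+1:
   index n below stands for n + 1 in the usual numbering of basis vectors,
   interface sequences and towers.  The shift is spelled out wherever the value
   of an index matters (approx_window, gen_instance, gen_info). *)

Record sci_problem (R : realType) := SCIProblem {
  inst : Type;
  out : metricType R;
  target : inst -> out;
  info : set (inst -> R[i]);
  info_sep : forall A B, target A <> target B ->
    exists2 f, info f & f A <> f B }.

Arguments inst {R} s.
Arguments out {R} s.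
Arguments target {R} s _.
Arguments info {R} s _.

Section Towers.
Context {R : realType}.
Implicit Types P S : sci_problem R.

Record general_algorithm P := GeneralAlgorithm {
  ga_fun : inst P -> out P;
  ga_query : inst P -> set (inst P -> R[i]);
  ga_query_finite : forall A, finite_set (ga_query A);
  ga_query_info : forall A, ga_query A `<=` info P;
  ga_consistent : forall A B, (forall f, ga_query A f -> f B = f A) ->
    ga_fun B = ga_fun A /\ ga_query B = ga_query A }.

(* For t = (n_k, ..., n_1): the limits in n_1, ..., n_k, n_1 innermost, all
   exist and the last one is l. *)
Fixpoint iterated_lim (M : metricType R) (k : nat) :
    (k.-tuple nat -> M) -> M -> Prop :=
  match k with
  | 0 => fun u l => u [tuple] = l
  | k'.+1 => fun u l => exists v : nat -> M,
      (forall n, iterated_lim (fun t => u [tuple of n :: t]) (v n)) /\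
      v @ \oo --> l
  end.

Definition has_tower P (k : nat) : Prop :=
  exists G : k.-tuple nat -> general_algorithm P,
    forall A, iterated_lim (fun t => ga_fun (G t) A) (target P A).

(* None stands for the value infinity. *)
Definition SCI_G P : option nat :=
  match pselect (exists k, `[< has_tower P k >]) with
  | left h => Some (ex_minn h)
  | right _ => None
  end.

(* The joint image; for m = 0 it is the whole (one-point) set of 0-tuples, even
   when there are no instances. *)
Definition joint_image S (m : nat) (g : 'I_m -> inst S -> R[i]) :
    set ('I_m -> R[i]) :=
  [set v | m = 0%N \/ exists A, v = (fun i => g i A)].

Definition raw_reducible S P : Prop :=
  exists (E : inst S -> inst P) (D : out P -> out S),
    [/\ continuous D,
        forall A, D (target P (E A)) = target S A &
        forall f, info P f ->
          exists (m : nat) (g : 'I_m -> inst S -> R[i])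
                 (theta : ('I_m -> R[i]) -> R[i]),
            [/\ forall i, info S (g i),
                forall v, joint_image g v -> range f (theta v) &
                forall A, f (E A) = theta (fun i => g i A)]].

Definition raw_equiv P Q : Prop := raw_reducible P Q /\ raw_reducible Q P.

End Towers.

(* Sets of problems and sets of degrees are plain predicates: the type of
   problems contains a metricType and is too large a type for [set]. *)
Section Degrees.
Context {R : realType}.
Local Notation problem_class := (sci_problem R -> Prop).
Implicit Types (U X Y : problem_class) (k : nat).

Definition SCI_level k U : problem_class :=
  fun P => U P /\ SCI_G P = Some k.

Definition raw_class k U (P : sci_problem R) : problem_class :=
  fun Q => SCI_level k U Q /\ raw_equiv Q P.

Definition raw_degrees k U : problem_class -> Prop :=
  fun X => exists2 P, SCI_level k U P & X = raw_class k U P.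

Definition degree_le X Y : Prop :=
  exists P Q, [/\ X P, Y Q & raw_reducible P Q].

Definition min_degrees k U : problem_class -> Prop :=
  fun X => raw_degrees k U X /\
    forall Y, raw_degrees k U Y -> degree_le Y X -> Y = X.

End Degrees.

(* bool already carries a uniform structure for which every ball is a
   singleton, which is not the one of the 0/1-valued metric; hence an alias. *)
Definition bit (R : realType) : Type := bool.

HB.instance Definition _ (R : realType) := Choice.copy (bit R) bool.

Section BitMetric.
Context (R : realType).
Implicit Types x y z : bit R.

Definition bit_dist x y : R := (x != y)%:R.

Lemma bit_distxx x : bit_dist x x = 0.
Proof. by rewrite /bit_dist eqxx. Qed.

Lemma bit_dist_positivity x y : bit_dist x y = 0 -> x = y.
Proof. by rewrite /bit_dist; case: eqP => // _ /eqP; rewrite oner_eq0. Qed.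

Lemma bit_dist_sym x y : bit_dist x y = bit_dist y x.
Proof. by rewrite /bit_dist eq_sym. Qed.

Lemma bit_dist_triangle y x z : bit_dist x z <= bit_dist x y + bit_dist y z.
Proof.
rewrite /bit_dist -natrD ler_nat.
by move: x y z => [] [] [].
Qed.

HB.instance Definition _ := isMetric.Build R (bit R)
  bit_distxx bit_dist_positivity bit_dist_sym bit_dist_triangle.

End BitMetric.

Section Operators.
Context {R : realType} {I : choiceType}.
Local Notation C := R[i].
Local Notation vec := (I -> C).
Implicit Types (x y : vec) (A : set (vec * vec)).

Definition cabs (z : C) : R := ComplexField.Normc.normc z.

Definition l2norm x : \bar R :=
  sqrte (\esum_(i in [set: I]) ((cabs (x i)) ^+ 2)%:E)%E.

Definition ell2 : set vec := [set x | (l2norm x < +oo)%E].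

(* Sum of an absolutely summable real family. *)
Definition rsum (u : I -> R) : R :=
  fine (\esum_(i in [set: I]) (Num.max (u i) 0)%:E) -
  fine (\esum_(i in [set: I]) (Num.max (- u i) 0)%:E).

Definition inner x y : C :=
  rsum (fun i => complex.Re (x i * conjc (y i))) +i*
  rsum (fun i => complex.Im (x i * conjc (y i))).

Definition basis (i : I) : vec := fun j => (j == i)%:R.

Definition basis_span : set vec :=
  [set x | exists (s : seq I) (c : I -> C), x = \sum_(i <- s) c i *: basis i].

(* An unbounded operator is identified with its graph. *)
Record is_linop A : Prop := IsLinop {
  linop_ell2 : forall x y, A (x, y) -> ell2 x /\ ell2 y;
  linop_zero : A (0, 0);
  linop_linear : forall (a : C) x y x' y', A (x, y) -> A (x', y') ->
    A (a *: x + x', a *: y + y');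
  linop_functional : forall x y y', A (x, y) -> A (x, y') -> y = y' }.

Definition dom A : set vec := [set x | exists y, A (x, y)].

(* Only meaningful for x in the domain. *)
Definition app A x : vec := xget 0 [set y | A (x, y)].

Definition restrict A (D : set vec) : set (vec * vec) :=
  [set p | D p.1 /\ A p].

Definition graph_closure A : set (vec * vec) :=
  [set p | [/\ ell2 p.1, ell2 p.2 & forall e : R, 0 < e ->
    exists2 q, A q &
      (l2norm (p.1 - q.1)%R < e%:E)%E /\ (l2norm (p.2 - q.2)%R < e%:E)%E]].

Definition densely_defined A : Prop :=
  forall x, ell2 x -> forall e : R, 0 < e ->
    exists2 u, dom A u & (l2norm (x - u)%R < e%:E)%E.

Definition closed_op A : Prop := graph_closure A = A.

Definition is_core A (D : set vec) : Prop :=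
  D `<=` dom A /\ graph_closure (restrict A D) = A.

Definition adjoint A : set (vec * vec) :=
  [set p | [/\ ell2 p.1, ell2 p.2 &
    forall x y, A (x, y) -> inner y p.1 = inner x p.2]].

Definition opnorm (T : vec -> vec) : \bar R :=
  ereal_sup [set l2norm (T x) | x in [set x | (l2norm x <= 1)%E]].

(* A (x, y + z *: x) says that (A - z) x = y. *)
Definition resolvent A (z : C) (y : vec) : vec :=
  xget 0 [set x | A (x, y + z *: x)].

Definition resolvent_set A : set C :=
  [set z | (forall y, ell2 y -> exists! x, A (x, y + z *: x)) /\
           (opnorm (resolvent A z) < +oo)%E].

Definition spectrum A : set C := ~` resolvent_set A.

Definition resolvent_norm A (z : C) : \bar R :=
  if pselect (spectrum A z) then +oo%E else opnorm (resolvent A z).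

Definition pseudospectrum (e : R) A : set C :=
  closure ([set z | ((e^-1)%R%:E < resolvent_norm A z)%E] : set C^o).

Definition matrix_entry A (i j : I) : C := inner (app A (basis j)) (basis i).

Record core_operator A : Prop := CoreOperator {
  core_linop : is_linop A;
  core_dense : densely_defined A;
  core_closed : closed_op A;
  core_core : is_core A basis_span;
  core_core_adjoint : is_core (adjoint A) basis_span }.

Lemma rsum_basis (u : I -> R) (i : I) :
  (forall j, j != i -> u j = 0) -> rsum u = u i.
Proof.
move=> u0.
have E (v : I -> R) : (forall j, j != i -> v j = 0) -> 0 <= v i ->
    fine (\esum_(j in [set: I]) (v j)%:E) = v i.
  move=> v0 vi.
  have -> : \esum_(j in [set: I]) (v j)%:E = \esum_(j in [set i]) (v j)%:E.
    rewrite esum_mkcond [RHS]esum_mkcond; apply: eq_esum => j _.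
    rewrite in_setT; case: ifPn => //; rewrite notin_setE /= => /eqP ji.
    by rewrite v0.
  by rewrite esum_set1 ?lee_fin.
rewrite /rsum (E (fun j => Num.max (u j) 0)) ?(E (fun j => Num.max (- u j) 0)) //.
- by rewrite /Num.max; case: ltrgtP => // [ui|ui|->]; case: ltrgtP => //;
    rewrite ?subr0 ?sub0r ?opprK // ?oppr_lt0 ?oppr_gt0; lra.
- by move=> j /u0 ->; rewrite oppr0 maxxx.
- by rewrite le_max lexx orbT.
- by move=> j /u0 ->; rewrite maxxx.
- by rewrite le_max lexx orbT.
Qed.

Lemma inner_basis x (i : I) : inner x (basis i) = x i.
Proof.
rewrite /inner !(@rsum_basis _ i) /basis.
- by rewrite eqxx [true%:R]mulr1n conjc1 mulr1; case: (x i).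
- by move=> j /negPf ->; rewrite [false%:R]mulr0n conjc0 mulr0.
- by move=> j /negPf ->; rewrite [false%:R]mulr0n conjc0 mulr0.
Qed.

Lemma app_graph A x : dom A x -> A (x, app A x).
Proof. by case=> y Axy; apply: (@xgetPex _ 0 [set y | A (x, y)]); exists y. Qed.

Lemma matrix_entry_inj A B : core_operator A -> core_operator B ->
  (forall i j, matrix_entry A i j = matrix_entry B i j) -> A = B.
Proof.
move=> hA hB AB.
have basis_in i : basis_span (basis i).
  by exists [:: i], (fun=> 1); rewrite big_seq1 scale1r.
have on_basis i : app A (basis i) = app B (basis i).
  by apply/funext => j; have := AB j i; rewrite /matrix_entry !inner_basis.
have on_span (T : set (vec * vec)) : core_operator T ->
    forall (s : seq I) (c : I -> C),
    T (\sum_(i <- s) c i *: basis i, \sum_(i <- s) c i *: app T (basis i)).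
  move=> hT s c; elim: s => [|i s IHs].
    by rewrite !big_nil; exact: linop_zero (core_linop hT).
  rewrite !big_cons; apply: (linop_linear (core_linop hT) _ _ IHs).
  by apply: app_graph; apply: (core_core hT).1.
have sub (S T : set (vec * vec)) : core_operator S -> core_operator T ->
    (forall i, app S (basis i) = app T (basis i)) ->
    restrict S basis_span `<=` restrict T basis_span.
  move=> hS hT ST [x y] [/= [s [c xE]] Sxy]; split; first by exists s, c.
  move: Sxy; rewrite xE => Sxy.
  rewrite (linop_functional (core_linop hS) Sxy (on_span _ hS s c)).
  rewrite (_ : \sum_(i <- s) c i *: app S (basis i) =
    \sum_(i <- s) c i *: app T (basis i)); first exact: on_span.
  by apply: eq_bigr => i _; rewrite ST.
rewrite -(core_core hA).2 -(core_core hB).2; congr graph_closure.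
by apply/seteqP; split; apply: sub.
Qed.

End Operators.

Section Windows.
Context {R : realType}.

Definition K_sgl (J : set R) : set (set R[i]) :=
  [set K | exists2 x, J x & K = [set x%:C]].

Definition window (J : set R) : Type := {K : set R[i] | K_sgl J K}.

(* approx n stands for r_(n+1). *)
Record approx_window (J : set R) := ApproxWindow {
  approx :> nat -> window J -> R[i];
  approx_rat : forall n K, exists p q : rat, approx n K = ratr p +i* ratr q;
  approx_le : forall n (K : window J) z, sval K = [set z] ->
    cabs (approx n K - z) <= 2^-1 ^+ n.+2 }.

Definition window_info (J : set R) (r : approx_window J) (T : Type) :
    set (T * window J -> R[i]) :=
  [set f | exists n, f = fun p => r n p.2].

Definition avoids (J : set R) (S : set R[i]) (K : window J) : bit R :=
  `[< S `&` sval K = set0 >].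

Lemma cabs_Re_Im (z : R[i]) :
  `|complex.Re z| <= cabs z /\ `|complex.Im z| <= cabs z.
Proof.
case: z => a b; rewrite /cabs /= -2!sqrtr_sqr.
by split; apply: ler_wsqrtr; rewrite ?lerDl ?lerDr sqr_ge0.
Qed.

Lemma approx_inj (J : set R) (r : approx_window J) (K L : window J) :
  (forall n, r n K = r n L) -> K = L.
Proof.
move=> KL.
have [x _ Kx] := svalP K; have [y _ Ly] := svalP L.
suff xy : x = y.
  by case: K L Kx Ly {KL} => [K hK] [L hL] /= Kx Ly; apply: eq_exist;
     rewrite Kx Ly xy.
have close n : `|x - y| <= 2^-1 ^+ n.
  have [hx _] := cabs_Re_Im (r n K - x%:C).
  have [hy _] := cabs_Re_Im (r n L - y%:C).
  have := approx_le r n Kx; have := approx_le r n Ly.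
  move: hx hy; rewrite KL; case: (r n L) => p q /= hx hy hy' hx'.
  have {hx'}hx := le_trans hx hx'; have {hy'}hy := le_trans hy hy'.
  have -> : x - y = (p - y) - (p - x) by ring.
  rewrite (le_trans (ler_normB _ _)) // (le_trans (lerD hy hx)) //.
  have h0 : 0 <= 2^-1 ^+ n :> R by rewrite exprn_ge0 // invr_ge0.
  by rewrite !exprS; lra.
apply/eqP; rewrite -subr_eq0 -normr_eq0 eq_le normr_ge0 andbT.
have l0 : (fun n : nat => 2^-1 ^+ n : R) @ \oo --> 0.
  by apply: cvg_expr; rewrite ger0_norm ?invr_ge0 // invf_lt1 // ltr1n.
rewrite -(cvg_lim (@Rhausdorff R) l0).
by apply: limr_ge; [exact: cvgP l0 | exact: nearW].
Qed.

End Windows.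

Section Problems.
Context {R : realType} {J : set R}.
Local Notation C := R[i].
Variable r : approx_window J.

Section WindowProblem.
Context {Omega : Type}.
Variable base : set (Omega * window J -> C).
Variable S : Omega -> set C.
Hypothesis base_sep : forall p q,
  (forall f, base f -> f p = f q) -> S p.1 = S q.1.

Lemma window_info_sep (p q : Omega * window J) :
  avoids (S p.1) p.2 <> avoids (S q.1) q.2 ->
  exists2 f, (window_info r (T:=Omega) `|` base) f & f p <> f q.
Proof.
move=> npq; apply: contrapT => nf; apply: npq.
have eq_info f : (window_info r (T:=Omega) `|` base) f -> f p = f q.
  by move=> hf; apply: contrapT => ?; apply: nf; exists f.
congr avoids; last first.
  by apply: (@approx_inj _ _ r) => n; apply: (eq_info (fun p => r n p.2));
     left; exists n.
by apply: base_sep => f bf; apply: eq_info; right.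
Qed.

Definition window_problem : sci_problem R :=
  @SCIProblem R (Omega * window J) (bit R)
    (fun p => avoids (S p.1) p.2) (window_info r (T:=Omega) `|` base)
    window_info_sep.

End WindowProblem.

Definition diag_op (a : nat -> C) : set ((nat -> C) * (nat -> C)) :=
  [set p | [/\ ell2 p.1, ell2 p.2 & forall j, p.2 j = a j * p.1 j]].

(* The instances are the diagonal sequences, in bijection with the maximal
   diagonal operators. *)
Definition diag_info : set ((nat -> C) * window J -> C) :=
  [set f | exists j, f = fun p => p.1 j].

Lemma diag_sep (S : set ((nat -> C) * (nat -> C)) -> set C)
    (p q : (nat -> C) * window J) :
  (forall f, diag_info f -> f p = f q) -> S (diag_op p.1) = S (diag_op q.1).
Proof.
move=> pq; congr (S (diag_op _)); apply/funext => j.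
by apply: (pq (fun p => p.1 j)); exists j.
Qed.

Definition diag_problem (S : set ((nat -> C) * (nat -> C)) -> set C) :
  sci_problem R :=
  @window_problem _ diag_info (fun a => S (diag_op a)) (@diag_sep S).

Definition trunc (n : nat) (x : nat -> C) : nat -> C :=
  fun i => if (i < n)%N then x i else 0.

(* (I - P_m) A P_n *)
Definition off_block (A : set ((nat -> C) * (nat -> C))) (m n : nat)
    (x : nat -> C) : nat -> C :=
  let y := app A (trunc n x) in y - trunc m y.

Definition dispersion (A : set ((nat -> C) * (nat -> C))) (m n : nat) :
    \bar R :=
  maxe (opnorm (off_block A m n)) (opnorm (off_block (adjoint A) m n)).

(* gen_f n + 1 and gen_c n stand for f(n+1) and c_(n+1). *)
Record gen_instance := GenInstance {
  gen_op : set ((nat -> C) * (nat -> C));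
  gen_core : core_operator gen_op;
  gen_f : nat -> nat;
  gen_c : nat -> rat;
  gen_c_ge0 : forall n, 0 <= gen_c n;
  gen_c_null : (fun n => ratr (gen_c n) : R) @ \oo --> (0 : R);
  gen_dispersion : forall n,
    (dispersion gen_op (gen_f n).+1 n.+1 <= (ratr (gen_c n) : R)%:E)%E }.

Definition gen_info : set (gen_instance * window J -> C) :=
  [set f | exists i j, f = fun p => matrix_entry (gen_op p.1) i j] `|`
  [set f | exists n, f = fun p => (gen_f p.1 n).+1%:R] `|`
  [set f | exists n, f = fun p => ratr (gen_c p.1 n)].

Lemma gen_sep (S : set ((nat -> C) * (nat -> C)) -> set C)
    (p q : gen_instance * window J) :
  (forall f, gen_info f -> f p = f q) -> S (gen_op p.1) = S (gen_op q.1).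
Proof.
move=> pq; congr S; apply: matrix_entry_inj; try exact: gen_core.
move=> i j; apply: (pq (fun p => matrix_entry (gen_op p.1) i j)).
by left; left; exists i, j.
Qed.

Definition gen_problem (S : set ((nat -> C) * (nat -> C)) -> set C) :
  sci_problem R :=
  @window_problem _ gen_info (fun a => S (gen_op a)) (@gen_sep S).

End Problems.

(* A connected simple graph with an enumeration v_1, v_2, ... of its
   countably infinite vertex set. *)
Record countable_graph := CountableGraph {
  vertex :> choiceType;
  adj : rel vertex;
  adj_sym : symmetric adj;
  adj_irr : irreflexive adj;
  adj_connected : forall u w : vertex, exists2 s, path adj u s & last u s = w;
  vtx : nat -> vertex;
  vtx_bij : bijective vtx }.

Section GraphProblem.
Context {R : realType} {J : set R}.
Local Notation C := R[i].
Variable r : approx_window J.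
Variables (G : countable_graph) (code : {fset G} -> nat).

Record graph_instance := GraphInstance {
  graph_op : set ((G -> C) * (G -> C));
  graph_core : core_operator graph_op;
  graph_supp : G -> {fset G};
  graph_suppP : forall v w, w \notin graph_supp v ->
    matrix_entry graph_op v w = 0 /\ matrix_entry graph_op w v = 0 }.

Definition graph_info : set (graph_instance * window J -> C) :=
  [set f | exists i j,
     f = fun p => matrix_entry (graph_op p.1) (vtx G i) (vtx G j)] `|`
  [set f | exists i, f = fun p => (code (graph_supp p.1 (vtx G i)))%:R].

Lemma graph_sep (S : set ((G -> C) * (G -> C)) -> set C)
    (p q : graph_instance * window J) :
  (forall f, graph_info f -> f p = f q) -> S (graph_op p.1) = S (graph_op q.1).
Proof.
move=> pq; congr S; apply: matrix_entry_inj; try exact: graph_core.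
have [g _ vtxK] := vtx_bij G.
move=> v w; rewrite -[v]vtxK -[w]vtxK; set i := g v; set j := g w.
apply: (pq (fun p => matrix_entry (graph_op p.1) (vtx G i) (vtx G j))).
by left; exists i, j.
Qed.

Definition graph_problem (S : set ((G -> C) * (G -> C)) -> set C) :
  sci_problem R :=
  @window_problem R J r _ graph_info (fun a => S (graph_op a)) (@graph_sep S).

End GraphProblem.

Section Ambient.
Context {R : realType} {J : set R}.
Variables (eps : R) (r : approx_window J).
Variables (G : countable_graph) (code : {fset G} -> nat).

Definition P_sigma_diag := diag_problem r spectrum.
Definition P_sigma_gen := gen_problem r spectrum.
Definition P_sigma_graph := graph_problem r code spectrum.
Definition P_pseudo_diag := diag_problem r (pseudospectrum eps).
Definition P_pseudo_gen := gen_problem r (pseudospectrum eps).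
Definition P_pseudo_graph := graph_problem r code (pseudospectrum eps).

Definition six_problems : sci_problem R -> Prop := fun P =>
  [\/ P = P_sigma_diag, P = P_sigma_gen | P = P_sigma_graph] \/
  [\/ P = P_pseudo_diag, P = P_pseudo_gen | P = P_pseudo_graph].

End Ambient.

(* Main.v *)
Require Import Defs.
From mathcomp Require Import all_boot all_order all_algebra finmap.
From mathcomp Require Import all_classical all_reals all_analysis.
From mathcomp Require Import complex ring lra.

Set Implicit Arguments.
Unset Strict Implicit.
Unset Printing Implicit Defensive.

Import Order.TTheory GRing.Theory Num.Theory.
Import numFieldNormedType.Exports.

Local Open Scope classical_set_scope.
Local Open Scope ring_scope.

(** The least degree is represented by the diagonal spectral problem because it
reduces to every other problem of the ambient, while its height is exactly 2: a
problem of level k that reduces to all members of the ambient represents the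
unique minimal degree of level k ([min_degrees_least]).

Diagonal instances are instances of the two richer classes.  The diagonal
operator with sequence a, over any index set, is a core operator whose matrix
entries are 0 or values of a; it has dispersion 0 for f = id and c = 0, and the
support {v} at every vertex v.  Hence every query to the image instance is a
constant or a single query to a ([diag_le_gen], [diag_le_graph]).  Transport to
the vertex set of the graph is harmless, because spectrum and pseudospectrum
depend on a only through dist(z, {a_j}): they are the points where this
distance is at most 0, respectively at most eps ([spectrum_mult_op],
[pseudospectrum_mult_op]).

The two diagonal problems reduce to each other.  One must turn a sequence a
into a sequence b with dist(z, b) <= eps iff dist(z, a) = 0, or with
dist(z, b) = 0 iff dist(z, a) <= eps, where the point z of the window is
accessible only through the approximations r_m and each b_k may use finitely
many queries.  For a nonnegative 1-Lipschitz function F, the points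
r_m + F(|a_j - r_m|) + 2^-m have distance to z between F(|a_j - z|) and
F(|a_j - z|) + 2 * 2^-m: the slack 2^-m dominates the errors of the
approximation, so no point comes too close, and it vanishes as m grows.  Thus
the distance of b to z is inf_j F(|a_j - z|) ([thickening_shift_seq]), and
F t = eps + |t| and F t = max(0, t - eps) give the two reductions
([sigma_le_pseudo], [pseudo_le_sigma]).

The height of the diagonal spectral problem is 2.  That z is not in the
spectrum says that there is n such that |a_j - z| >= 2^-n for all j; both
quantifiers become monotone limits ([sigma_diag_tower2]).  One limit is not
enough: restricted to sequences a_j = z + 1/(c_j + 1) the question is whether
the sequence c of naturals is bounded, every finite prefix extends both to a
bounded and to an unbounded sequence, and an adversary who alternates between
the two extensions, each time waiting until the algorithm gives the current
answer and then freezing the finitely many values read, produces a sequence on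
which the outputs oscillate ([not_limit_of_finite_queries],
[sigma_diag_no_tower1]). *)

(* Not the notion of a basis of a topology. *)
Local Notation basis := Defs.basis.

(** * The modulus of a complex number *)

Section Modulus.
Context {R : realType}.
Implicit Types z w : R[i].

Lemma cabs0 : cabs 0 = 0 :> R.
Proof. exact: ComplexField.Normc.normc0. Qed.

Lemma cabs1 : cabs 1 = 1 :> R.
Proof. exact: ComplexField.Normc.normc1. Qed.

Lemma cabsM z w : cabs (z * w) = cabs z * cabs w.
Proof. exact: ComplexField.Normc.normcM. Qed.

Lemma cabsV z : cabs z^-1 = (cabs z)^-1.
Proof. exact: ComplexField.Normc.normcV. Qed.

Lemma cabsD z w : cabs (z + w) <= cabs z + cabs w.
Proof. exact: le_normcD. Qed.

Lemma cabsN z : cabs (- z) = cabs z.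
Proof. exact: normcN. Qed.

Lemma cabsBC z w : cabs (z - w) = cabs (w - z).
Proof. by rewrite -cabsN opprB. Qed.

Lemma cabs_ge0 z : 0 <= cabs z.
Proof. by case: z => x y; rewrite sqrtr_ge0. Qed.

Lemma cabs_eq0 z : cabs z = 0 -> z = 0.
Proof. exact: ComplexField.Normc.eq0_normc. Qed.

Lemma cabs_real (x : R) : cabs x%:C%C = `|x|.
Proof. by rewrite /cabs /= expr0n /= addr0 sqrtr_sqr. Qed.

(** Multiplication by the inverses of numbers that stay away from 0 is a bounded
operator. *)
Lemma cabs_div_le z w (d : R) : 0 < d -> d <= cabs w ->
  cabs (z / w) <= d^-1 * cabs z.
Proof.
move=> d0 dw; rewrite cabsM cabsV mulrC ler_wpM2r ?cabs_ge0 //.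
by rewrite lef_pV2 ?posrE // (lt_le_trans d0).
Qed.

Lemma half_pow_lt (d : R) : 0 < d ->
  exists N, forall n, (N <= n)%N -> 2^-1 ^+ n < d.
Proof.
move=> d0; have l0 : (fun n : nat => 2^-1 ^+ n : R) @ \oo --> 0.
  by apply: cvg_expr; rewrite ger0_norm ?invr_ge0 // invf_lt1 // ltr1n.
have /cvgrPdist_lt /(_ _ d0)[N _ hN] := l0; exists N => n /hN /=.
by rewrite sub0r normrN ger0_norm // exprn_ge0 // invr_ge0.
Qed.

End Modulus.

(** * Square-summable families *)

Section SquareSummable.
Context {R : realType} {I : choiceType}.
Implicit Types (x y : I -> R[i]) (s t : seq I).

Local Notation sqsum x := (\esum_(i in [set: I]) ((cabs (x i)) ^+ 2)%:E)%E.

Lemma sqsum_ge0 x : (0 <= sqsum x)%E.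
Proof. by apply: esum_ge0 => i _; rewrite lee_fin sqr_ge0. Qed.

(** Reduces estimates on norms to finite sums of reals. *)
Lemma sqsum_leP x (b : R) :
  (sqsum x <= b%:E)%E <->
  forall s, uniq s -> \sum_(i <- s) cabs (x i) ^+ 2 <= b.
Proof.
split=> [xb s us|xb].
  rewrite -lee_fin (le_trans _ xb) //; apply: esum_ge.
  exists [set` s]; first by split=> //; exact: finite_seq.
  by rewrite -fsbig_seq // sumEFin.
apply: ge_ereal_sup => _ [F [finF _]] <-.
by rewrite fsbig_finite //= sumEFin lee_fin xb.
Qed.

Lemma l2norm_ge0 x : (0 <= l2norm x)%E.
Proof. exact: sqrte_ge0. Qed.

Lemma EFin_sqrte_sqr (c : R) : 0 <= c -> c%:E = sqrte (c ^+ 2)%:E.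
Proof. by move=> c0; rewrite /= sqrtr_sqr ger0_norm. Qed.

Lemma le_l2normE (c : R) x : 0 <= c ->
  (l2norm x <= c%:E)%E = (sqsum x <= (c ^+ 2)%:E)%E.
Proof. by move=> c0; rewrite EFin_sqrte_sqr // lee_sqrt ?lee_fin ?sqr_ge0. Qed.

Lemma lt_l2normE (c : R) x : 0 <= c ->
  (l2norm x < c%:E)%E = (sqsum x < (c ^+ 2)%:E)%E.
Proof. by move=> c0; rewrite EFin_sqrte_sqr // !ltNge lee_sqrt ?sqsum_ge0. Qed.

Lemma ell2P x : ell2 x <-> exists2 c : R, 0 <= c & (l2norm x <= c%:E)%E.
Proof.
split=> [|[c _ xc]]; last exact: le_lt_trans xc (ltry c).
rewrite /ell2 /=; have := l2norm_ge0 x; case: (l2norm x) => // c c0 _.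
by exists c; rewrite -?lee_fin.
Qed.

Lemma le_l2norm_scale x y (c b : R) : 0 <= c -> 0 <= b ->
  (forall i, cabs (x i) <= c * cabs (y i)) ->
  (l2norm y <= b%:E)%E -> (l2norm x <= (c * b)%:E)%E.
Proof.
move=> c0 b0 xy; rewrite !le_l2normE ?mulr_ge0 // => /sqsum_leP yb.
apply/sqsum_leP => s us; rewrite exprMn.
apply: le_trans (ler_wpM2l (sqr_ge0 c) (yb _ us)).
rewrite mulr_sumr; apply: ler_sum => i _.
by rewrite -exprMn lerXn2r ?nnegrE ?mulr_ge0 ?cabs_ge0.
Qed.

Lemma ell2_scale x y (c : R) : 0 <= c ->
  (forall i, cabs (x i) <= c * cabs (y i)) -> ell2 y -> ell2 x.
Proof.
move=> c0 xy /ell2P[b b0 yb]; apply/ell2P; exists (c * b); first exact: mulr_ge0.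
exact: le_l2norm_scale yb.
Qed.

Lemma ell2Z (c : R[i]) x : ell2 x -> ell2 (c *: x).
Proof.
apply: (@ell2_scale _ _ (cabs c)); first exact: cabs_ge0.
by move=> i; rewrite -cabsM.
Qed.

Lemma ell2D x y : ell2 x -> ell2 y -> ell2 (x + y).
Proof.
move=> /ell2P[b b0 xb] /ell2P[c c0 yc]; apply/ell2P.
move: xb yc; rewrite !le_l2normE // => /sqsum_leP xb /sqsum_leP yc.
have d0 : 0 <= 2 * b ^+ 2 + 2 * c ^+ 2.
  by rewrite addr_ge0 // mulr_ge0 // sqr_ge0.
exists (Num.sqrt (2 * b ^+ 2 + 2 * c ^+ 2)); first exact: sqrtr_ge0.
rewrite le_l2normE ?sqrtr_ge0 // sqr_sqrtr //; apply/sqsum_leP => s us.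
apply: (@le_trans _ _ (2 * (\sum_(i <- s) cabs (x i) ^+ 2) +
                       2 * (\sum_(i <- s) cabs (y i) ^+ 2))); last first.
  by rewrite lerD // ler_wpM2l // (xb, yc).
rewrite !mulr_sumr -big_split; apply: ler_sum => i _ /=.
(* (p + q)^2 <= 2 p^2 + 2 q^2, by (p - q)^2 >= 0. *)
rewrite (le_trans (_ : _ <= (cabs (x i) + cabs (y i)) ^+ 2)) //.
  by rewrite lerXn2r ?nnegrE ?addr_ge0 ?cabs_ge0 ?cabsD.
have := sqr_ge0 (cabs (x i) - cabs (y i)); nra.
Qed.

Lemma coord_le_l2norm x i : ((cabs (x i))%:E <= l2norm x)%E.
Proof.
rewrite leNgt lt_l2normE ?cabs_ge0 // -leNgt; apply: esum_ge.
exists [set i]; first by split => //; exact: finite_set1.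
by rewrite fsbig_set1.
Qed.

Lemma coord_lt x i (e : R) : (l2norm x < e%:E)%E -> cabs (x i) < e.
Proof. by move/(le_lt_trans (coord_le_l2norm x i)); rewrite lte_fin. Qed.

Lemma l2norm_basisZ (c : R[i]) (i : I) : l2norm (c *: basis i) = (cabs c)%:E.
Proof.
apply/eqP; rewrite eq_le; apply/andP; split; last first.
  have := coord_le_l2norm (c *: basis i) i.
  by rewrite -[(c *: _) i]/(c * basis i i) /basis eqxx mulr1.
rewrite le_l2normE ?cabs_ge0 //; apply/sqsum_leP => s us.
have z j : j != i -> cabs ((c *: basis i) j) ^+ 2 = 0.
  move=> /negPf ji; rewrite -[(c *: _) j]/(c * basis i j) /basis ji.
  by rewrite mulr0 cabs0 expr0n.
case: (boolP (i \in s)) => is_; last first.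
  rewrite big1_seq ?sqr_ge0 // => j /= js; apply: z.
  by apply: contraNneq is_ => <-.
rewrite (bigD1_seq i) //= big1 ?addr0; last by move=> j; exact: z.
by rewrite -[(c *: _) i]/(c * basis i i) /basis eqxx mulr1.
Qed.

Lemma l2norm0 : l2norm (0 : I -> R[i]) = 0%E.
Proof.
apply/eqP; rewrite eq_le l2norm_ge0 andbT le_l2normE //.
by apply/sqsum_leP => s us; rewrite big1 ?expr0n // => i _; rewrite cabs0 expr0n.
Qed.

Lemma ell2_0 : ell2 (0 : I -> R[i]).
Proof. by rewrite /ell2 /= l2norm0. Qed.

Definition cutoff s x : I -> R[i] := fun i => if i \in s then x i else 0.

Lemma cutoff_basis_span s x : basis_span (cutoff s x).
Proof.
exists (undup s), x; apply/funext => j; rewrite /cutoff fct_sumE.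
under eq_bigr => i _ do rewrite -[(_ *: _) j]/(x i * (j == i)%:R).
case: ifPn => js.
  rewrite (bigD1_seq j) ?undup_uniq ?mem_undup //= eqxx mulr1 big1 ?addr0 //.
  by move=> i /negPf; rewrite eq_sym => ->; rewrite mulr0.
rewrite big1_seq // => i /=; rewrite mem_undup => is_.
by case: eqP is_ js => [->->|]; rewrite ?mulr0.
Qed.

Lemma basis_span_cutoff x : basis_span x -> exists s, x = cutoff s x.
Proof.
move=> [s [c ->]]; exists s; apply/funext => j; rewrite /cutoff; case: ifPn => // js.
rewrite fct_sumE big1_seq // => i /= is_; rewrite -[LHS]/(c i * (j == i)%:R).
by case: eqP => [ji|]; rewrite ?mulr0 //; rewrite ji is_ in js.
Qed.

Lemma cutoff_ell2 s x : ell2 (cutoff s x).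
Proof.
apply/ell2P; exists (Num.sqrt (\sum_(i <- undup s) cabs (x i) ^+ 2)).
  exact: sqrtr_ge0.
have s0 t : 0 <= \sum_(i <- t) cabs (x i) ^+ 2.
  by apply: sumr_ge0 => i _; exact: sqr_ge0.
rewrite le_l2normE ?sqrtr_ge0 // sqr_sqrtr //; apply/sqsum_leP => t ut.
rewrite (bigID (mem s)) /= [X in _ + X]big1 ?addr0; last first.
  by move=> i /negPf is_; rewrite /cutoff is_ cabs0 expr0n.
under eq_bigr => i is_ do rewrite /cutoff is_.
rewrite [leRHS](bigID (mem t)) /=.
have -> : \sum_(i <- t | i \in s) cabs (x i) ^+ 2 =
          \sum_(i <- undup s | i \in t) cabs (x i) ^+ 2.
  rewrite -[LHS]big_filter -[RHS]big_filter; apply: perm_big; apply: uniq_perm.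
  - exact: filter_uniq.
  - by rewrite filter_uniq // undup_uniq.
  by move=> i; rewrite !mem_filter mem_undup andbC.
by rewrite lerDl; apply: sumr_ge0 => i _; exact: sqr_ge0.
Qed.

(** The estimate holds for all larger index lists as well, so that one list can
serve both components of a point of a graph. *)
Lemma cutoff_approx x (e : R) : ell2 x -> 0 < e ->
  exists s, forall t, {subset s <= t} -> (l2norm (x - cutoff t x)%R < e%:E)%E.
Proof.
move=> /ell2P[c c0]; rewrite le_l2normE // => xc e0.
have [S xS] : exists S, sqsum x = S%:E.
  by move: xc (sqsum_ge0 x); case: (sqsum x) => // S _ _; exists S.
have e2 : 0 < e ^+ 2 / 2 by rewrite divr_gt0 // exprn_gt0.
have /sqsum_leP Sx : (sqsum x <= S%:E)%E by rewrite xS.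
have [s us sS] : exists2 s, uniq s & S - e ^+ 2 / 2 < \sum_(i <- s) cabs (x i) ^+ 2.
  apply: contrapT => h.
  have : (sqsum x <= (S - e ^+ 2 / 2)%:E)%E.
    by apply/sqsum_leP => s us; rewrite leNgt; apply/negP => ?; apply: h; exists s.
  by rewrite xS lee_fin; lra.
exists s => t st; rewrite lt_l2normE ?(ltW e0) //.
apply: (@le_lt_trans _ _ (e ^+ 2 / 2)%:E); last by rewrite lte_fin; lra.
apply/sqsum_leP => u uu.
have E i : (x - cutoff t x) i = if i \in t then 0 else x i.
  by rewrite -[LHS]/(x i - cutoff t x i) /cutoff; case: ifP; rewrite ?subrr ?subr0.
rewrite (bigID (mem t)) /= [X in X + _]big1 ?add0r; last first.
  by move=> i it; rewrite E it cabs0 expr0n.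
under eq_bigr => i /negPf it do rewrite E it.
(* The terms of [u] outside [t] are disjoint from [s], which already carries all
but e^2 / 2 of the sum. *)
have /Sx : uniq (s ++ [seq i <- u | i \notin t]).
  rewrite cat_uniq us filter_uniq // andbT; apply/hasPn => i.
  by rewrite mem_filter => /andP[+ _]; apply: contra => /st.
by rewrite big_cat big_filter /=; lra.
Qed.

End SquareSummable.

(** * Diagonal operators over an arbitrary index set *)

Section MultiplicationOperator.
Context {R : realType} {I : choiceType}.
Implicit Types (a x y : I -> R[i]) (z w : R[i]) (s t : seq I) (i j : I).

(** Stated for every index type, so as to cover both the naturals and the vertices
of a graph. *)
Definition mult_op a : set ((I -> R[i]) * (I -> R[i])) :=
  [set p | [/\ ell2 p.1, ell2 p.2 & forall j, p.2 j = a j * p.1 j]].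

Lemma mult_op_linop a : is_linop (mult_op a).
Proof.
split.
- by move=> x y [].
- by split; [exact: ell2_0|exact: ell2_0|move=> j; rewrite mulr0].
- move=> c x y x' y' [/= x2 y2 xy] [/= x2' y2' xy']; split => /=.
  + by apply: ell2D => //; exact: ell2Z.
  + by apply: ell2D => //; exact: ell2Z.
  + move=> j; rewrite -[LHS]/(c * y j + y' j) xy xy' -[(_ + _) j]/(c * x j + x' j).
    by rewrite mulrDr mulrCA.
- move=> x y y' [/= _ _ xy] [/= _ _ xy']; apply/funext => j.
  by rewrite xy xy'.
Qed.

Lemma mult_op_cutoff a x s : mult_op a (cutoff s x, cutoff s (fun j => a j * x j)).
Proof.
split; [exact: cutoff_ell2|exact: cutoff_ell2|move=> j /=].
by rewrite /cutoff; case: ifP; rewrite ?mulr0.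
Qed.

(** The relation y_j = a_j x_j involves one coordinate at a time, and coordinates
are continuous for the norm. *)
Lemma mult_op_closed a : closed_op (mult_op a).
Proof.
apply/seteqP; split=> [[x y] [/= x2 y2 xy]|[x y] [/= x2 y2 xy]]; last first.
  split=> // e e0; exists (x, y) => //=.
  by rewrite !subrr (_ : l2norm 0 = 0%E) ?lte_fin //; exact: l2norm0.
split=> //= j; apply/eqP; rewrite -subr_eq0; apply/eqP/cabs_eq0.
apply/eqP; rewrite eq_le cabs_ge0 andbT; apply/ler_addgt0Pl => e e0.
rewrite addr0; set k := 1 + cabs (a j).
have k0 : 0 < k by rewrite ltr_pwDl // cabs_ge0.
have [[x' y'] [/= _ _ xy'] [xx' yy']] := xy (e / k) (divr_gt0 e0 k0).
have hx : cabs (x j - x' j) < e / k := coord_lt j xx'.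
have hy : cabs (y j - y' j) < e / k := coord_lt j yy'.
have -> : y j - a j * x j = (y j - y' j) + - (a j * (x j - x' j)).
  by rewrite xy'; ring.
rewrite (le_trans (cabsD _ _)) // cabsN cabsM.
have -> : e = e / k * k by rewrite divfK // gt_eqF.
rewrite {2}/k mulrDr mulr1 lerD ?(ltW hy) //.
by rewrite mulrC ler_wpM2r ?cabs_ge0 // ltW.
Qed.

Lemma mult_op_dense a : densely_defined (mult_op a).
Proof.
move=> x x2 e e0; have [s xs] := cutoff_approx x2 e0.
exists (cutoff s x); last exact: xs.
by eexists; exact: mult_op_cutoff.
Qed.

Lemma graph_closureS (A B : set ((I -> R[i]) * (I -> R[i]))) :
  A `<=` B -> graph_closure A `<=` graph_closure B.
Proof.
move=> AB p [p1 p2 pA]; split=> // e /pA[q Aq ?].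
by exists q => //; exact: AB.
Qed.

(** Cutting off both components of a point of the graph gives a point of the graph,
over a finitely supported vector. *)
Lemma mult_op_core a : is_core (mult_op a) basis_span.
Proof.
split.
  move=> x /basis_span_cutoff[s xs]; exists (cutoff s (fun j => a j * x j)).
  by rewrite {1}xs; exact: mult_op_cutoff.
apply/seteqP; split.
  by rewrite -[X in _ `<=` X]mult_op_closed; apply: graph_closureS => p [].
move=> [x y] [/= x2 y2 xy]; split=> //= e e0.
have [s xs] := cutoff_approx x2 e0; have [t yt] := cutoff_approx y2 e0.
exists (cutoff (s ++ t) x, cutoff (s ++ t) y) => /=.
  split; first exact: cutoff_basis_span.
  by rewrite (_ : y = (fun j => a j * x j)) //; [exact: mult_op_cutoff|exact/funext].
by split; [apply: xs|apply: yt] => i it; rewrite mem_cat it ?orbT.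
Qed.

Lemma innerZbasisl (c : R[i]) i y : inner (c *: basis i) y = c * conjc (y i).
Proof.
have E j : (c *: basis i) j * conjc (y j) = (j == i)%:R * (c * conjc (y j)).
  by rewrite -[(c *: _) j]/(c * (j == i)%:R); ring.
rewrite /inner !(@rsum_basis _ _ _ i).
- by rewrite E eqxx mul1r; case: (c * _).
- by move=> j /negPf ji; rewrite E ji mul0r.
- by move=> j /negPf ji; rewrite E ji mul0r.
Qed.

Lemma basis_ell2Z (c : R[i]) i : ell2 (c *: basis i).
Proof. by rewrite /ell2 /= l2norm_basisZ ltry. Qed.

Lemma mult_op_basisZ a (c : R[i]) i : mult_op a (c *: basis i, (a i * c) *: basis i).
Proof.
split; [exact: basis_ell2Z|exact: basis_ell2Z|move=> j /=].
rewrite -[LHS]/(a i * c * (j == i)%:R) -[(_ *: _) j]/(c * (j == i)%:R).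
by case: eqP => [->|]; rewrite ?mulr1 ?mulr0.
Qed.

(** Testing against the basis vectors, which lie in the domain, determines an
element of the adjoint coordinate by coordinate. *)
Lemma adjoint_mult_op a : adjoint (mult_op a) = mult_op (fun j => conjc (a j)).
Proof.
apply/seteqP; split=> [[u v] [/= u2 v2 uv]|[u v] [/= u2 v2 uv]]; split=> //=.
  move=> j; have := uv _ _ (mult_op_basisZ a 1 j).
  rewrite !innerZbasisl mulr1 mul1r => h.
  by rewrite -[v j]conjcK -h rmorphM /= conjcK.
move=> x y [/= _ _ xy].
have E j : y j * conjc (u j) = x j * conjc (v j).
  by rewrite uv xy rmorphM /= conjcK; ring.
by rewrite /inner; congr (_ +i* _)%C; congr rsum; apply/funext => j; rewrite E.
Qed.

Lemma mult_op_core_operator a : core_operator (mult_op a).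
Proof.
split; [exact: mult_op_linop|exact: mult_op_dense|exact: mult_op_closed
       |exact: mult_op_core|rewrite adjoint_mult_op; exact: mult_op_core].
Qed.

(** Holds outside the domain too, since [app] is 0 there. *)
Lemma app_mult_op0 a x i : x i = 0 -> app (mult_op a) x i = 0.
Proof.
move=> xi; rewrite /app; case: xgetP => [y -> [_ _ /= ->]|//].
by rewrite xi mulr0.
Qed.

Lemma matrix_entry_mult_op a i j :
  matrix_entry (mult_op a) i j = if i == j then a j else 0.
Proof.
have D : mult_op a (basis j, a j *: basis j).
  by have := mult_op_basisZ a 1 j; rewrite mulr1 scale1r.
rewrite /matrix_entry inner_basis.
have /(linop_functional (mult_op_linop a) D) <- :
    mult_op a (basis j, app (mult_op a) (basis j)).
  by apply: app_graph; eexists; exact: D.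
rewrite -[LHS]/(a j * (i == j)%:R).
by case: eqP; rewrite ?mulr1 ?mulr0.
Qed.

(** The set of points at distance at most e from the set of values of a. *)
Definition thickening (e : R) a : set R[i] :=
  [set z | forall d : R, 0 < d -> exists i, cabs (a i - z) < e + d].

Lemma mult_op_shift a x y z :
  mult_op a (x, y + z *: x) <->
  [/\ ell2 x, ell2 y & forall j, y j = (a j - z) * x j].
Proof.
split=> [[/= x2 yx2 yx]|[x2 y2 yx]].
  have E j : y j = (a j - z) * x j.
    have := yx j; rewrite -[(y + z *: x) j]/(y j + z * x j) => h.
    by rewrite mulrBl -h addrK.
  split=> //; have := ell2D yx2 (ell2Z (- z) x2).
  by rewrite scaleNr addrK.
split=> //=; first by apply: ell2D => //; exact: ell2Z.
move=> j; rewrite -[LHS]/(y j + z * x j) yx; ring.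
Qed.

Lemma gap_neq0 a z (d : R) i : 0 < d -> (forall i, d <= cabs (a i - z)) ->
  a i - z != 0.
Proof. by move=> d0 dz; apply: contraTneq (dz i) => ->; rewrite cabs0 -ltNge. Qed.

Lemma resolvent_mult_op a z (d : R) y : 0 < d -> (forall i, d <= cabs (a i - z)) ->
  ell2 y -> mult_op a (fun j => y j / (a j - z),
                       y + z *: (fun j => y j / (a j - z))).
Proof.
move=> d0 dz y2; apply/mult_op_shift; split=> //; last first.
  by move=> j; rewrite mulrC divfK // (gap_neq0 _ d0).
apply: (@ell2_scale _ _ _ y d^-1) => //; first by rewrite invr_ge0 ltW.
by move=> i; exact: cabs_div_le.
Qed.

Lemma opnorm_le (T : (I -> R[i]) -> I -> R[i]) (c : R) :
  (forall x, (l2norm x <= 1)%E -> (l2norm (T x) <= c%:E)%E) -> (opnorm T <= c%:E)%E.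
Proof. by move=> h; apply: ge_ereal_sup => _ [x /= x1 <-]; exact: h. Qed.

Lemma ell2_unit x : (l2norm x <= 1)%E -> ell2 x.
Proof. by move=> x1; apply: le_lt_trans x1 (ltry 1). Qed.

Lemma resolvent_mult_opE a z (d : R) y : 0 < d -> (forall i, d <= cabs (a i - z)) ->
  ell2 y -> resolvent (mult_op a) z y = fun j => y j / (a j - z).
Proof.
move=> d0 dz y2; apply: xget_unique; first exact: resolvent_mult_op dz y2.
move=> x /mult_op_shift[_ _ yx]; apply/funext => j.
by rewrite yx mulrAC divff ?mul1r // (gap_neq0 _ d0).
Qed.

Lemma opnorm_resolvent_le a z (d : R) : 0 < d -> (forall i, d <= cabs (a i - z)) ->
  (opnorm (resolvent (mult_op a) z) <= d^-1%:E)%E.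
Proof.
move=> d0 dz; apply: opnorm_le => y y1.
rewrite (resolvent_mult_opE d0 dz (ell2_unit y1)) -[d^-1]mulr1.
apply: (@le_l2norm_scale _ _ _ y) => //; first by rewrite invr_ge0 ltW.
by move=> i; exact: cabs_div_le.
Qed.

(** If the resolvent has norm at most c, then applying it to the i-th basis vector
gives 1 / |a_i - z| <= c. *)
Lemma resolvent_set_mult_op a z :
  resolvent_set (mult_op a) z <->
  exists2 d : R, 0 < d & forall i, d <= cabs (a i - z).
Proof.
split=> [[sol bdd]|[d d0 dz]]; last first.
  split; last exact: le_lt_trans (opnorm_resolvent_le d0 dz) (ltry _).
  move=> y y2; exists (fun j => y j / (a j - z)); split.
    exact: resolvent_mult_op dz y2.
  move=> x /mult_op_shift[_ _ yx]; apply/funext => j.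
  by rewrite yx mulrAC divff ?mul1r // (gap_neq0 _ d0).
have [c [c0 hc]] : exists c : R,
    0 < c /\ (opnorm (resolvent (mult_op a) z) <= c%:E)%E.
  move: bdd; case: (opnorm _) => [c _|//|_]; last by exists 1; rewrite leNye.
  exists (Num.max c 1); rewrite lt_max ltr01 orbT; split=> //.
  by rewrite lee_fin le_max lexx.
exists c^-1 => [|i]; first by rewrite invr_gt0.
have [x [sx _]] := sol _ (basis_ell2Z 1 i).
have := @xgetI _ 0 [set x | mult_op a (x, 1 *: basis i + z *: x)] x sx.
rewrite -[xget _ _]/(resolvent (mult_op a) z (1 *: basis i)).
set u := resolvent _ _ _ => /mult_op_shift[_ _ /(_ i)].
rewrite -[(1 *: _) i]/(1 * (i == i)%:R) eqxx mulr1 => ui.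
have : cabs (u i) <= c.
  rewrite -lee_fin (le_trans (coord_le_l2norm u i)) // (le_trans _ hc) //.
  by apply: ereal_sup_ubound; exists (1 *: basis i);
    rewrite //= l2norm_basisZ cabs1.
have : cabs (a i - z) * cabs (u i) = 1 by rewrite -cabsM -ui cabs1.
have := cabs_ge0 (a i - z); have := cabs_ge0 (u i).
move: (cabs _) (cabs _) => p q p0 q0 qp pc.
by rewrite -div1r ler_pdivrMr // -qp ler_wpM2l.
Qed.

Lemma spectrum_mult_op a : spectrum (mult_op a) = thickening 0 a.
Proof.
apply/seteqP; split=> z.
  move=> sz d d0; apply: contrapT => h; apply: sz; apply/resolvent_set_mult_op.
  exists d => // i; rewrite leNgt; apply/negP => id; apply: h; exists i.
  by rewrite add0r.
move=> tz /resolvent_set_mult_op[d d0 dz].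
by have [i id] := tz d d0; move: id; rewrite add0r ltNge dz.
Qed.

(** The norm of the resolvent at z is 1 / dist(z, {a_i}). *)
Lemma resolvent_norm_gt a z (e : R) : 0 < e ->
  (e^-1%:E < resolvent_norm (mult_op a) z)%E <-> exists i, cabs (a i - z) < e.
Proof.
move=> e0; rewrite /resolvent_norm; case: pselect => [sz|nsz]; last first.
  have /resolvent_set_mult_op[d d0 dz] := contrapT nsz.
  split=> [h|[i ie]].
    apply: contrapT => k; move: h; apply/negP; rewrite -leNgt.
    apply: opnorm_resolvent_le => // i; rewrite leNgt; apply/negP => ie.
    by apply: k; exists i.
  apply: (@lt_le_trans _ _ (cabs (a i - z))^-1%:E).
    by rewrite lte_fin ltf_pV2 ?posrE // (lt_le_trans d0).
  apply: (@le_trans _ _ (l2norm (resolvent (mult_op a) z (1 *: basis i)))).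
    rewrite (resolvent_mult_opE d0 dz); last exact: basis_ell2Z.
    apply: le_trans (coord_le_l2norm _ i).
    by rewrite -[(1 *: _) i]/(1 * (i == i)%:R) eqxx mulr1 div1r cabsV.
  by apply: ereal_sup_ubound; exists (1 *: basis i);
    rewrite //= l2norm_basisZ cabs1.
rewrite ltry; split=> // _; move: sz; rewrite spectrum_mult_op => /(_ e e0) [i ie].
by exists i; rewrite -[e]add0r.
Qed.

(** Balls of the normed space of complex numbers have complex radii; positive ones
are real. *)
Lemma closure_complexP (S : set R[i]) z :
  closure (S : set R[i]^o) z <->
  forall d : R, 0 < d -> exists2 w, S w & cabs (z - w) < d.
Proof.
split=> [cz d d0|h B /nbhs_ballP[e e0 eB]].
  have d0C : 0 < (d%:C)%C :> R[i] by rewrite ltcR.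
  have [w [Sw]] := cz _ (nbhsx_ballx (z : R[i]^o) _ d0C).
  by rewrite -ball_normE /= ltcR => zw; exists w.
have eE : e = ((complex.Re e)%:C)%C by rewrite RRe_real // gtr0_real.
have e0R : 0 < complex.Re e by rewrite -ltcR -eE.
have [w Sw zw] := h _ e0R; exists w; split=> //; apply: eB.
by rewrite -ball_normE /= eE ltcR.
Qed.

(** In the complex plane the closure of {dist < e} is {dist <= e}: a point at
distance slightly more than e from a_i can be moved towards a_i. *)
Lemma pseudospectrum_mult_op a (e : R) : 0 < e ->
  pseudospectrum e (mult_op a) = thickening e a.
Proof.
move=> e0; apply/seteqP; split=> z.
  move=> /closure_complexP cz d /cz[w /(resolvent_norm_gt _ _ e0)[i ie] zw].
  exists i; have -> : a i - z = (a i - w) + - (z - w) by ring.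
  by rewrite (le_lt_trans (cabsD _ _)) // cabsN ltrD.
move=> tz; apply/closure_complexP => d d0; have d20 : 0 < d / 2 by rewrite divr_gt0.
have [i iz] := tz _ d20.
suff [w iw zw] : exists2 w, cabs (a i - w) < e & cabs (z - w) < d.
  by exists w => //; apply/resolvent_norm_gt => //; exists i.
have [ui|iu] := ltP (cabs (a i - z)) (d / 2).
  exists (a i); rewrite ?subrr ?cabs0 // cabsBC; lra.
have u0 : 0 < cabs (a i - z) by apply: lt_le_trans iu.
set u := cabs (a i - z) in iz iu u0.
(* The point is moved by d / 2 along the segment from z to a_i. *)
pose t := (d / 2) / u.
have t1 : t <= 1 by rewrite ler_pdivrMr ?mul1r.
have t0 : 0 < t by rewrite divr_gt0.
have tu : t * u = d / 2 by rewrite divfK // gt_eqF.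
exists (z + (t%:C)%C * (a i - z)).
  have -> : a i - (z + (t%:C)%C * (a i - z)) = ((1 - t)%:C)%C * (a i - z).
    by rewrite rmorphB rmorph1; ring.
  rewrite cabsM cabs_real -/u ger0_norm ?subr_ge0 // mulrBl mul1r tu; lra.
rewrite opprD addNKr cabsN cabsM cabs_real -/u gtr0_norm // tu; lra.
Qed.

End MultiplicationOperator.

(** * Raw finite-query reductions and minimal degrees *)

Section FiniteQueryReductions.
Context {R : realType}.
Implicit Types P Q S : sci_problem R.

Definition determined_by {X Y T : Type} (F : set (X -> Y)) (h : X -> T) : Prop :=
  forall A B, (forall g, F g -> g A = g B) -> h A = h B.

(** The recovery maps are arbitrary, so they exist as soon as finitely many queries
determine the value; this form composes without bookkeeping of indices.  The
instance [A0] supplies a value outside the joint image. *)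
Lemma raw_reducibleP S P (A0 : inst S) :
  raw_reducible S P <->
  exists (E : inst S -> inst P) (D : out P -> out S),
    [/\ continuous D,
        forall A, D (target P (E A)) = target S A &
        forall f, info P f -> exists F : set (inst S -> R[i]),
          [/\ finite_set F, F `<=` info S & determined_by F (f \o E)]].
Proof.
split=> -[E [D [Dc DE red]]]; exists E, D; split=> // f /red.
  move=> [m [g [theta [gS _ fE]]]]; exists (range g); split.
  - exact: finite_image.
  - by move=> _ [i _ <-].
  - move=> A B AB; rewrite /= !fE; congr theta; apply/funext => i.
    by apply: AB; exists i.
move=> [F [/finite_seqP[s Fs] FS fF]].
pose g (i : 'I_(size s)) := nth (fun=> 0) s i.
exists (size s), g, (fun v =>
  match pselect (exists A, v = fun i => g i A) with
  | left h => f (E (projT1 (cid h)))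
  | right _ => f (E A0)
  end); split.
- by move=> i; apply: FS; rewrite Fs /= mem_nth.
- by move=> v _; case: pselect => ?; eexists.
- move=> A; case: pselect => [h|]; last by case; exists A.
  case: cid => B /= gAB; apply: fF => h'.
  rewrite Fs /= => /(nthP (fun=> 0))[i is_ <-].
  by have /(congr1 (fun v => v (Ordinal is_))) := gAB.
Qed.

Lemma raw_reducible_refl P : inst P -> raw_reducible P P.
Proof.
move=> A0; apply/raw_reducibleP => //; exists id, id; split=> //.
  by move=> x; exact: cvg_id.
move=> f fP; exists [set f]; split; first exact: finite_set1.
  by move=> _ ->.
by move=> A B; apply.
Qed.

Lemma raw_reducible_trans Q S P : inst S ->
  raw_reducible S Q -> raw_reducible Q P -> raw_reducible S P.
Proof.
move=> A0 SQ; have := SQ; have [E0 _] := SQ.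
move=> /(raw_reducibleP _ A0)[E [D [Dc DE red]]].
move=> /(raw_reducibleP _ (E0 A0))[E' [D' [Dc' DE' red']]].
apply/(raw_reducibleP _ A0); exists (E' \o E), (D \o D'); split.
- by move=> x; apply: continuous_comp; [exact: Dc'|exact: Dc].
- by move=> A; rewrite /= DE' DE.
move=> f /red'[F [finF FQ fF]].
(* Each query to the middle problem costs finitely many queries to the first one. *)
have /choice[Phi PhiP] : forall g, exists G : set (inst S -> R[i]), info Q g ->
    [/\ finite_set G, G `<=` info S & determined_by G (g \o E)].
  move=> g; have [/red[G ?]|ng] := pselect (info Q g); first by exists G.
  by exists set0.
exists (\bigcup_(g in F) Phi g); split.
- by apply: bigcup_finite => // g /FQ /PhiP[].
- by move=> h [g /FQ /PhiP[_ + _]]; exact.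
- move=> A B AB; apply: fF => g Fg; have [_ _ gG] := PhiP _ (FQ _ Fg).
  by apply: gG => h gh; apply: AB; exists g.
Qed.

Lemma raw_class_eq k (U : sci_problem R -> Prop) P Q : inst P ->
  raw_equiv P Q -> raw_class k U P = raw_class k U Q.
Proof.
move=> A0 [PQ QP]; have [E _] := PQ; have B0 := E A0.
apply/funext => T; apply/propext; split=> -[UT [TP PT]];
  have [E' _] := PT; split=> //.
  split; first exact: raw_reducible_trans (E' A0) TP PQ.
  exact: raw_reducible_trans B0 QP PT.
split; first exact: raw_reducible_trans (E' B0) TP QP.
exact: raw_reducible_trans A0 PQ PT.
Qed.

(** A least element of a preorder represents its unique minimal class. *)
Lemma min_degrees_least k (U : sci_problem R -> Prop) P : inst P ->
  SCI_level k U P -> (forall Q, U Q -> raw_reducible P Q) ->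
  min_degrees k U = (fun X => X = raw_class k U P).
Proof.
move=> A0 UP least.
have A0Q Q : U Q -> inhabited (inst Q).
  by move=> /least[E _]; exact: inhabits (E A0).
apply/funext => X; apply/propext; split=> [[[Q UQ ->] minX]|->].
  rewrite -(minX (raw_class k U P)) //; first by exists P.
  have [B0] := A0Q _ UQ.1; exists P, Q; split; last exact: (least _ UQ.1).
    by split=> //; split; exact: raw_reducible_refl.
  by split=> //; split; exact: raw_reducible_refl.
split; first by exists P.
move=> _ [Q UQ ->] [Q' [P' [[_ [Q'Q QQ']] [_ [P'P PP']] Q'P']]].
have [B0] := A0Q _ UQ.1.
apply: (raw_class_eq _ _ B0); split; last exact: least UQ.1.
have [E _] := QQ'.
apply: (raw_reducible_trans B0 QQ').
exact: raw_reducible_trans (E B0) Q'P' P'P.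
Qed.

End FiniteQueryReductions.

(** * Reductions that keep the window *)

Section WindowReductions.
Context {R : realType} {J : set R}.
Variable r : approx_window J.

Lemma avoids_eq (S T : set R[i]) (K : window J) :
  (forall z, sval K = [set z] -> S z <-> T z) -> avoids S K = avoids T K.
Proof.
move=> ST; have [x _ Kx] := svalP K; have {}ST := ST _ Kx.
rewrite /avoids Kx; congr (`[< _ = set0 >]); apply/seteqP.
by split=> z [Sz /= zx]; split=> //; move: Sz; rewrite zx => /ST.
Qed.

Lemma window_reduction (Omega Omega' : Type)
    (base : set (Omega * window J -> R[i])) (base' : set (Omega' * window J -> R[i]))
    (S : Omega -> set R[i]) (S' : Omega' -> set R[i]) sep sep'
    (e : Omega * window J -> Omega') : Omega * window J ->
  (forall p, avoids (S' (e p)) p.2 = avoids (S p.1) p.2) ->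
  (forall f, base' f -> exists F : set (Omega * window J -> R[i]),
    [/\ finite_set F, F `<=` window_info r (T:=Omega) `|` base &
        determined_by F (fun p => f (e p, p.2))]) ->
  raw_reducible (@window_problem _ _ r _ base S sep)
                (@window_problem _ _ r _ base' S' sep').
Proof.
move=> p0 eS red; apply/raw_reducibleP => //.
exists (fun p => (e p, p.2)), id; split.
- by move=> x; exact: cvg_id.
- by move=> p; rewrite /= eS.
move=> f [[n ->]|/red//].
exists [set (fun p => r n p.2)]; split; first exact: finite_set1.
  by move=> _ ->; left; exists n.
by move=> p q; apply.
Qed.

(** Surjectivity is all that is asked of this enumeration of pairs; the default
value (0, 0) merely repeats a pair. *)
Definition unpair (k : nat) : nat * nat := odflt (0%N, 0%N) (choice.unpickle k).

Lemma unpair_surj p : exists k, unpair k = p.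
Proof. by exists (choice.pickle p); rewrite /unpair choice.pickleK. Qed.

(** The k-th value uses only one value of a and one approximation of the window. *)
Definition shift_seq (F : R -> R) (a : nat -> R[i]) (K : window J) (k : nat) :
    R[i] :=
  let: (j, m) := unpair k in
  r m K + (F (cabs (a j - r m K)) + 2^-1 ^+ m)%:C%C.

(** Let h = 2^-m; then r_m is within h / 4 of z, so replacing r_m by z changes the
sum r_m - z and the argument of F by at most h / 4 each.  The summand h of the
shift compensates both errors, whence the lower bound F(|a_j - z|) for every m,
and the excess is at most 2 h, which tends to 0. *)
Lemma thickening_shift_seq (F : R -> R) (e : R) a (K : window J) z :
  (forall t, 0 <= F t) -> (forall t u, `|F t - F u| <= `|t - u|) ->
  sval K = [set z] ->
  thickening e (shift_seq F a K) z <->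
  forall d, 0 < d -> exists j, F (cabs (a j - z)) < e + d.
Proof.
move=> F0 Flip Kz.
have est k : let: (j, m) := unpair k in
    F (cabs (a j - z)) <= cabs (shift_seq F a K k - z) <=
    F (cabs (a j - z)) + 2 * 2^-1 ^+ m.
  rewrite /shift_seq; case: (unpair k) => j m.
  set h := 2^-1 ^+ m : R.
  have h0 : 0 < h by rewrite exprn_gt0 // invr_gt0.
  have := approx_le r m Kz; rewrite 2!exprS -/h.
  set q := r m K => hq.
  have tri (u v w : R[i]) : cabs (u - w) <= cabs (u - v) + cabs (v - w).
    by rewrite -[u - w](subrKA v) cabsD.
  have l1 : `|cabs (a j - q) - cabs (a j - z)| <= cabs (q - z).
    have := tri (a j) z q; have := tri (a j) q z; rewrite (cabsBC z q).
    by rewrite ler_norml => ? ?; apply/andP; split; lra.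
  have := le_trans (Flip _ _) l1.
  set s := F (cabs (a j - q)); set t := F (cabs (a j - z)).
  rewrite ler_norml => /andP[l2 l3].
  have s0 : 0 <= s by exact: F0.
  have -> : q + (s + h)%:C%C - z = (s + h)%:C%C + (q - z) by ring.
  have sh : cabs (s + h)%:C%C = s + h.
    by rewrite cabs_real ger0_norm // addr_ge0 // ltW.
  have up := cabsD (s + h)%:C%C (q - z).
  have lo := cabsD ((s + h)%:C%C + (q - z)) (- (q - z)).
  rewrite addrK cabsN in lo; rewrite sh in lo up.
  by apply/andP; split; lra.
split=> [tz d d0|h d d0].
  have [k kd] := tz d d0; have := est k; case: (unpair k) => j m /andP[jk _].
  by exists j; exact: le_lt_trans jk kd.
have d20 : 0 < d / 2 by rewrite divr_gt0.
have [j jd] := h _ d20.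
have d40 : 0 < d / 4 by rewrite divr_gt0.
have [m /(_ m (leqnn m)) md] := half_pow_lt d40.
have [k kE] := unpair_surj (j, m).
exists k; have := est k; rewrite kE => /andP[_ kj].
by apply: (le_lt_trans kj); lra.
Qed.

Lemma diag_reduction_shift (F : R -> R)
    (S S' : set ((nat -> R[i]) * (nat -> R[i])) -> set R[i]) (e : R) :
  window J -> (forall t, 0 <= F t) -> (forall t u, `|F t - F u| <= `|t - u|) ->
  (forall a, S' (diag_op a) = thickening e a) ->
  (forall a z, S (diag_op a) z <->
     forall d, 0 < d -> exists j, F (cabs (a j - z)) < e + d) ->
  raw_reducible (diag_problem r S) (diag_problem r S').
Proof.
move=> K0 F0 Flip S'E SE.
apply: (@window_reduction _ _ _ _ _ _ _ _ (fun p => shift_seq F p.1 p.2)).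
- exact: (0, K0).
- move=> p; apply: avoids_eq => z Kz; rewrite S'E.
  by apply: iff_trans (thickening_shift_seq _ _ F0 Flip Kz) _; apply: iff_sym.
move=> _ [k ->].
exists [set (fun p => p.1 (unpair k).1); (fun p => r (unpair k).2 p.2)]; split.
- by rewrite finite_setU; split; exact: finite_set1.
- by move=> _ [->|->]; [right; eexists|left; eexists].
- move=> p q pq; rewrite /shift_seq /=; have := pq _ (or_introl erefl).
  by have := pq _ (or_intror erefl); case: (unpair k) => j m /= -> ->.
Qed.

End WindowReductions.

(** * Diagonal instances inside the general and graph classes *)

Section Embeddings.
Context {R : realType} {J : set R}.
Variable r : approx_window J.

Lemma diag_op_mult (a : nat -> R[i]) : diag_op a = mult_op a.
Proof. by []. Qed.

Lemma off_block_mult_op a n x : off_block (mult_op a) n n x = 0 :> (nat -> R[i]).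
Proof.
apply/funext => i; rewrite /off_block -[LHS]/(_ - trunc n _ i) /trunc.
case: ltnP => ni; first by rewrite subrr.
by rewrite subr0 app_mult_op0 // ltnNge ni.
Qed.

Lemma dispersion_mult_op (a : nat -> R[i]) n : (dispersion (mult_op a) n n <= 0)%E.
Proof.
rewrite /dispersion adjoint_mult_op ge_max.
by apply/andP; split; apply: opnorm_le => x _; rewrite off_block_mult_op l2norm0.
Qed.

Lemma diag_gen_dispersion (a : nat -> R[i]) (n : nat) :
  (dispersion (mult_op a) (id n).+1 n.+1 <= (ratr ((fun=> 0) n) : R)%:E)%E.
Proof. by rewrite rmorph0; exact: dispersion_mult_op. Qed.

Lemma zero_null : (fun n => ratr ((fun=> 0 : rat) n : rat) : R) @ \oo --> (0 : R).
Proof. by under eq_fun do rewrite rmorph0; exact: cvg_cst. Qed.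

Definition diag_gen (a : nat -> R[i]) : @gen_instance R :=
  @GenInstance R (mult_op a) (mult_op_core_operator a) id (fun=> 0)
    (fun=> lexx 0) zero_null (diag_gen_dispersion a).

Lemma diag_le_gen S : window J -> raw_reducible (diag_problem r S) (gen_problem r S).
Proof.
move=> K0; apply: (@window_reduction _ _ _ _ _ _ _ _ _ _ _ (fun p => diag_gen p.1)).
- exact: (0, K0).
- by [].
have cst (c : R[i]) : exists F : set ((nat -> R[i]) * window J -> R[i]),
    [/\ finite_set F, F `<=` window_info r (T:=nat -> R[i]) `|` diag_info (J:=J) &
        determined_by F (fun=> c)].
  by exists set0; split.
move=> f [[[i [j ->]]|[n ->]]|[n ->]] /=; [|exact: cst|exact: cst].
exists [set (fun p => p.1 j)]; split; first exact: finite_set1.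
  by move=> _ ->; right; exists j.
by move=> p q pq; rewrite !matrix_entry_mult_op (pq _ erefl).
Qed.

Variables (G : countable_graph) (code : {fset G} -> nat).

Lemma vtx_invP : exists g : G -> nat, cancel (vtx G) g.
Proof. by have [g gK _] := vtx_bij G; exists g. Qed.

Definition vtx_inv : G -> nat := projT1 (cid vtx_invP).

Lemma vtxK : cancel (vtx G) vtx_inv.
Proof. exact: projT2 (cid vtx_invP). Qed.

(** A diagonal matrix couples a vertex only to itself. *)
Lemma diag_graph_supp (a : G -> R[i]) v w : w \notin [fset v]%fset ->
  matrix_entry (mult_op a) v w = 0 /\ matrix_entry (mult_op a) w v = 0.
Proof.
by rewrite inE => /negPf wv; rewrite !matrix_entry_mult_op wv eq_sym wv.
Qed.

Definition diag_graph (a : nat -> R[i]) : @graph_instance R G :=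
  @GraphInstance R G (mult_op (a \o vtx_inv)) (mult_op_core_operator _)
    (fun v => [fset v]%fset) (@diag_graph_supp _).

Lemma thickening_vtx_inv (e : R) (a : nat -> R[i]) :
  thickening e (a \o vtx_inv) = thickening e a.
Proof.
apply/seteqP; split=> z tz d /tz[i id]; first by exists (vtx_inv i).
by exists (vtx G i); rewrite /= vtxK.
Qed.

Lemma diag_le_graph S S' : window J ->
  (forall a, S' (mult_op (a \o vtx_inv)) = S (mult_op a)) ->
  raw_reducible (diag_problem r S) (graph_problem r code S').
Proof.
move=> K0 SS'.
apply: (@window_reduction _ _ _ _ _ _ _ _ _ _ _ (fun p => diag_graph p.1)).
- exact: (0, K0).
- by move=> p; rewrite /= SS'.
move=> f [[i [j ->]]|[i ->]] /=; last by exists set0; split.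
exists [set (fun p => p.1 j)]; split; first exact: finite_set1.
  by move=> _ ->; right; exists j.
by move=> p q pq; rewrite !matrix_entry_mult_op /= vtxK (pq _ erefl).
Qed.

End Embeddings.

(** * Spectrum and pseudospectrum of diagonal operators *)

Section SpectrumPseudospectrum.
Context {R : realType} {J : set R}.
Variables (r : approx_window J) (eps : R).
Hypothesis eps_gt0 : 0 < eps.

(** With F t = eps + |t| the distance of z to the new sequence is
eps + dist(z, {a_j}). *)
Lemma sigma_le_pseudo : window J ->
  raw_reducible (P_sigma_diag r) (P_pseudo_diag eps r).
Proof.
move=> K0; apply: (@diag_reduction_shift _ _ r (fun t => eps + `|t|) _ _ eps K0).
- by move=> t; rewrite addr_ge0 // ltW.
- by move=> t u; rewrite opprD addrACA subrr add0r ler_dist_dist.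
- by move=> a; rewrite -pseudospectrum_mult_op.
move=> a z; rewrite diag_op_mult spectrum_mult_op.
by split=> h d /h[j jd]; exists j; move: jd;
  rewrite add0r ger0_norm ?cabs_ge0 // ltrD2l.
Qed.

(** With F t = max(0, t - eps) the distance of z to the new sequence is 0 exactly
when dist(z, {a_j}) <= eps. *)
Lemma pseudo_le_sigma : window J ->
  raw_reducible (P_pseudo_diag eps r) (P_sigma_diag r).
Proof.
move=> K0; pose F t := Num.max 0 (t - eps).
apply: (@diag_reduction_shift _ _ r F _ _ 0 K0); rewrite /F.
- by move=> t; rewrite le_max lexx.
- move=> t u; have := ler_norm (t - u); have := ler_norm (u - t).
  have := normr_ge0 (t - u); rewrite (distrC u t) ler_norml !maxEle => n0 n1 n2.
  by case: (leP 0 (t - eps)) => ?; case: (leP 0 (u - eps)) => ?;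
    apply/andP; split; lra.
- by move=> a; rewrite -spectrum_mult_op.
move=> a z; rewrite diag_op_mult pseudospectrum_mult_op //.
by split=> h d d0; have [j jd] := h d d0; exists j; move: jd;
  rewrite add0r gt_max d0 ltrBlDl.
Qed.

End SpectrumPseudospectrum.

(** * Towers of general algorithms *)

Section TowerHeights.
Context {R : realType}.
Implicit Types P : sci_problem R.

(** The added outermost limit is constant. *)
Lemma has_towerS P k : has_tower P k -> has_tower P k.+1.
Proof.
move=> [G GP]; exists (fun t : k.+1.-tuple nat => G (behead_tuple t)) => A.
exists (fun=> target P A); split; last exact: cvg_cst.
move=> n; rewrite (_ : (fun t => _) = (fun t => ga_fun (G t) A)); first exact: GP.
apply/funext => t; congr (ga_fun (G _) A).
by apply/val_inj.
Qed.

Lemma SCI_G_eqS P k : has_tower P k.+1 -> ~ has_tower P k -> SCI_G P = Some k.+1.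
Proof.
move=> towS ntow.
have le_tower i j : (i <= j)%N -> has_tower P i -> has_tower P j.
  by move=> ij Pi; rewrite -(subnK ij); elim: (j - i)%N => // m; exact: has_towerS.
rewrite /SCI_G; case: pselect => [h|[]]; last by exists k.+1; apply/asboolP.
congr Some; case: ex_minnP => m /asboolP Pm minm.
apply/eqP; rewrite eqn_leq minm /=; last exact/asboolP.
by rewrite ltnNge; apply/negP => mk; apply: ntow; exact: le_tower Pm.
Qed.

(** The metric is discrete. *)
Lemma bit_cvgP (u : nat -> bit R) (l : bit R) :
  u @ \oo --> l <-> exists N, forall n, (N <= n)%N -> u n = l.
Proof.
split=> [/cvg_ballP/(_ 1 ltr01)[N _ uN]|[N uN]].
  exists N => n /uN /=; rewrite ballEmdist /= /mdist /= /bit_dist.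
  by case: eqP => //; rewrite ltxx.
apply/cvg_ballP => e e0; exists N => // n /uN ->; exact: ballxx.
Qed.

Lemma nonadaptive_subproof P (F : set (inst P -> R[i])) (h : inst P -> out P) :
  determined_by F h -> forall A B, (forall f, F f -> f B = f A) ->
  h B = h A /\ F = F.
Proof. by move=> hF A B /hF. Qed.

Definition nonadaptive P (F : set (inst P -> R[i])) (finF : finite_set F)
    (FP : F `<=` info P) (h : inst P -> out P) (hF : determined_by F h) :
    general_algorithm P :=
  @GeneralAlgorithm R P h (fun=> F) (fun=> finF) (fun=> FP)
    (nonadaptive_subproof hF).

(** No pointwise limit of functions with finite use separates two classes that are
both dense.  The counterexample to convergence is built in stages (a, N), where
the values of a below N are frozen: each stage makes some g_n equal to true and
some g_n equal to false, with n arbitrarily large, on all sequences that agree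
with the frozen part. *)
Lemma not_limit_of_finite_queries (g : nat -> (nat -> nat) -> bool)
    (t : (nat -> nat) -> bool) :
  (forall n a, exists N, forall b, (forall j, (j < N)%N -> b j = a j) ->
    g n b = g n a) ->
  (forall a N c, exists2 b, (forall j, (j < N)%N -> b j = a j) & t b = c) ->
  ~ (forall a, exists N, forall n, (N <= n)%N -> g n a = t a).
Proof.
move=> gfin tdense glim.
have force a N c : exists b n M, [/\ (N <= n)%N, (N <= M)%N,
    forall j, (j < N)%N -> b j = a j &
    forall b', (forall j, (j < M)%N -> b' j = b j) -> g n b' = c].
  have [b ba tb] := tdense a N c; have [n0 gn0] := glim b.
  have [M0 gM0] := gfin (maxn N n0) b.
  exists b, (maxn N n0), (maxn N M0); split; rewrite ?leq_maxl // => b' b'b.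
  rewrite gM0 => [|j jM]; first by rewrite gn0 ?leq_maxr.
  by apply: b'b; rewrite leq_max jM orbT.
have step (s : (nat -> nat) * nat) : exists s' : (nat -> nat) * nat,
    [/\ (s.2 < s'.2)%N, forall j, (j < s.2)%N -> s'.1 j = s.1 j &
    forall b, (forall j, (j < s'.2)%N -> b j = s'.1 j) ->
    exists n1 n2, [/\ (s.2 <= n1)%N, (s.2 <= n2)%N, g n1 b = true & g n2 b = false]].
  have [b1 [n1 [M1 [Nn1 NM1 b1a g1]]]] := force s.1 s.2 true.
  have [b2 [n2 [M2 [Nn2 NM2 b2a g2]]]] := force b1 M1 false.
  exists (b2, M2.+1); split=> /=.
  - by rewrite ltnS (leq_trans NM1).
  - by move=> j js; rewrite b2a ?b1a // (leq_trans js).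
  move=> b bb2; exists n1, n2; split=> //; first exact: leq_trans NM1 Nn2.
    apply: g1 => j jM1; rewrite bb2 ?b2a //.
    by rewrite ltnS (leq_trans (ltnW jM1)).
  by apply: g2 => j jM2; rewrite bb2 // ltnS ltnW.
have [f fP] := choice step.
pose st k := iter k f ((fun=> 0%N), 0%N).
have stS k : st k.+1 = f (st k) by [].
have stlt k : (k <= (st k).2)%N.
  elim: k => // k IH; rewrite stS; have [lt _ _] := fP (st k).
  exact: leq_ltn_trans lt.
have stmon k l : (k <= l)%N -> ((st k).2 <= (st l).2)%N /\
    forall j, (j < (st k).2)%N -> (st l).1 j = (st k).1 j.
  move=> kl; rewrite -(subnK kl); elim: (l - k)%N => [|m [IH1 IH2]] //.
  rewrite addSn stS; have [lt eq _] := fP (st (m + k)%N); split.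
    by rewrite (leq_trans IH1) // ltnW.
  by move=> j jk; rewrite eq ?IH2 // (leq_trans jk).
(* By [stlt] the j-th value is frozen from stage j + 1 on. *)
pose b j := (st j.+1).1 j.
have bst k j : (j < (st k).2)%N -> b j = (st k).1 j.
  move=> jk; rewrite /b; have [kj|/ltnW jk'] := leqP k j.+1.
    by have [_ ->] := stmon _ _ kj.
  by have [_ ->] := stmon _ _ jk'; rewrite ?stlt.
have [N gN] := glim b.
have [_ _ /(_ b)] := fP (st N); rewrite -stS => /(_ (bst N.+1)).
move=> [n1 [n2 [n1N n2N g1 g2]]].
have := gN n1 (leq_trans (stlt N) n1N); rewrite g1 -(gN n2 (leq_trans (stlt N) n2N)).
by rewrite g2.
Qed.

End TowerHeights.

(** * The height of the diagonal spectral problem *)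

Section DiagonalHeight.
Context {R : realType} {J : set R}.
Variable r : approx_window J.

(** The tolerance 2^-m makes the condition weaker than |a_j - z| >= 2^-n for each
m and equivalent to it for all m together; testing all m up to n1, not only the
last one, makes the answers decreasing in n1. *)
Definition separated (n n1 : nat) (p : (nat -> R[i]) * window J) : Prop :=
  forall j m, (j <= n1)%N -> (m <= n1)%N ->
    2^-1 ^+ n - 2^-1 ^+ m <= cabs (p.1 j - r m p.2).

Definition separated_queries (n1 : nat) : set ((nat -> R[i]) * window J -> R[i]) :=
  (fun j p => p.1 j) @` `I_n1.+1 `|` (fun m p => r m p.2) @` `I_n1.+1.

Lemma separated_queries_finite n1 : finite_set (separated_queries n1).
Proof. by rewrite finite_setU; split; apply: finite_image; exact: finite_II. Qed.

Lemma separated_queries_info n1 : separated_queries n1 `<=` info (P_sigma_diag r).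
Proof. by move=> _ [[j _ <-]|[m _ <-]]; [right; exists j|left; exists m]. Qed.

Lemma separated_determined n n1 :
  determined_by (separated_queries n1) (fun p => `[< separated n n1 p >] : bit R).
Proof.
move=> p q pq.
have pq1 j : (j <= n1)%N -> p.1 j = q.1 j.
  by move=> jn; apply: (pq (fun p => p.1 j)); left; exists j.
have pq2 m : (m <= n1)%N -> r m p.2 = r m q.2.
  by move=> mn; apply: (pq (fun p => r m p.2)); right; exists m.
apply: asbool_equiv_eq; split=> h j m jn mn; have := h j m jn mn.
  by rewrite pq1 ?pq2.
by rewrite pq1 ?pq2.
Qed.

Definition separated_alg n n1 : general_algorithm (P_sigma_diag r) :=
  @nonadaptive R (P_sigma_diag r) _ (separated_queries_finite n1)
    (@separated_queries_info n1) _ (@separated_determined n n1).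

Lemma target_sigma_diag (a : nat -> R[i]) (K : window J) z : sval K = [set z] ->
  target (P_sigma_diag r) (a, K) = `[< ~ thickening 0 a z >].
Proof.
move=> Kz; rewrite /= diag_op_mult spectrum_mult_op /avoids Kz.
apply: asbool_equiv_eq; split=> [h tz|h].
  by have : (thickening 0 a `&` [set z]) z by []; rewrite h.
by apply/seteqP; split=> // w [tw /= wz]; apply: h; rewrite -wz.
Qed.

(** The inner limit says that |a_j - z| >= 2^-n for all j; the outer limit tells
whether this holds for some n, since it is preserved when n grows. *)
Lemma sigma_diag_tower2 : has_tower (P_sigma_diag r) 2.
Proof.
exists (fun t : 2.-tuple nat =>
  separated_alg (tnth t ord0) (tnth t (lift ord0 ord0))).
move=> [a K]; have [x _ Kx] := svalP K; set z := (x%:C)%C in Kx.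
pose v n : bit R := `[< forall n1, separated n n1 (a, K) >].
exists v; split=> [n|].
  exists (fun n1 => `[< separated n n1 (a, K) >]); split=> [n1 //|].
  apply/bit_cvgP; rewrite /v; case: (asboolP (forall n1, _)) => [h|h].
    by exists 0%N => n1 _; apply/asboolP.
  have /existsNP[N hN] := h; exists N => n1 Nn1; apply/asboolP => cl; apply: hN.
  by move=> j m jN mN; apply: cl; exact: leq_trans Nn1.
have h0 m : 0 < 2^-1 ^+ m :> R by rewrite exprn_gt0 // invr_gt0.
apply/bit_cvgP; rewrite (target_sigma_diag _ Kx).
case: (asboolP (~ _)) => [nt|/contrapT tz].
  have [d d0 dz] : exists2 d : R, 0 < d & forall i, d <= cabs (a i - z).
    apply: contrapT => h; apply: nt => d d0; apply: contrapT => k; apply: h.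
    exists d => // i; rewrite leNgt; apply/negP => id; apply: k; exists i.
    by rewrite add0r.
  have [N hN] := half_pow_lt d0; exists N => n Nn.
  apply/asboolP => n1 j m _ _ /=.
  have nd := hN n Nn.
  have := approx_le r m Kx; have := dz j.
  have := cabsD (a j - r m K) (r m K - z); rewrite subrKA 2!exprS; have := h0 m; lra.
(* With |a_j - z| < 2^-n / 2, the tolerance 2^-m for m = n + 2 is small enough to
refute the test. *)
exists 0%N => n _; apply/asboolP => cl.
have n20 : 0 < 2^-1 ^+ n / 2 :> R by rewrite divr_gt0.
have [j jn] := tz _ n20.
have := cl (maxn j n.+2) j n.+2 (leq_maxl _ _) (leq_maxr _ _) => /=.
have := approx_le r n.+2 Kx.
have := cabsD (a j - z) (- (r n.+2 K - z)); rewrite cabsN.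
have -> : a j - z - (r n.+2 K - z) = a j - r n.+2 K by ring.
rewrite !exprS; have := h0 n; lra.
Qed.

Lemma general_algorithm_finite_use (A : general_algorithm (P_sigma_diag r))
    (a : nat -> R[i]) (K : window J) :
  exists N, forall b, (forall j, (j < N)%N -> b j = a j) ->
    ga_fun A (b, K) = ga_fun A (a, K).
Proof.
have /finite_seqP[s sE] := ga_query_finite A (a, K).
have sI : forall f, f \in s -> info (P_sigma_diag r) f.
  by move=> f fs; apply: (@ga_query_info _ _ A (a, K)); rewrite sE.
suff [N hN] : exists N, forall b, (forall j, (j < N)%N -> b j = a j) ->
    forall f, f \in s -> f (b, K) = f (a, K).
  exists N => b ba; apply: (ga_consistent _).1 => f; rewrite sE; exact: hN.
elim: s sI {sE} => [|f s IH] sI; first by exists 0%N.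
have [|N hN] := IH; first by move=> g gs; apply: sI; rewrite inE gs orbT.
have [M hM] : exists M, forall b, (forall j, (j < M)%N -> b j = a j) ->
    f (b, K) = f (a, K).
  have [[n ->]|[j ->]] := sI f (mem_head _ _); first by exists 0%N.
  by exists j.+1 => b; exact.
exists (maxn N M) => b ba g; rewrite inE => /predU1P[->|gs].
  by apply: hM => j jM; apply: ba; rewrite leq_max jM orbT.
by apply: hN gs => j jN; apply: ba; rewrite leq_max jN.
Qed.

(** Values z + 1/(c_j + 1) never equal z, so that no finite prefix decides the
target: the tail c_j = 0 puts z outside the spectrum, the tail c_j = j inside. *)
Lemma sigma_diag_no_tower1 : window J -> ~ has_tower (P_sigma_diag r) 1.
Proof.
move=> K [G GP]; have [x _ Kx] := svalP K; set z := (x%:C)%C in Kx.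
pose a (c : nat -> nat) j : R[i] := z + ((c j).+1%:R^-1 : R)%:C%C.
have az c j : cabs (a c j - z) = (c j).+1%:R^-1.
  by rewrite /a addrC addKr cabs_real ger0_norm // invr_ge0.
apply: (@not_limit_of_finite_queries
  (fun n c => ga_fun (G [tuple n]) (a c, K))
  (fun c => target (P_sigma_diag r) (a c, K))).
- move=> n c; have [N hN] := general_algorithm_finite_use (G [tuple n]) (a c) K.
  by exists N => b bc; apply: hN => j jN; rewrite /a bc.
- move=> c N []; cbv beta.
    exists (fun j => if (j < N)%N then c j else 0%N); first by move=> j ->.
    rewrite (target_sigma_diag _ Kx); apply/asboolP => tz.
    pose M := (\max_(j < N) c j)%N.
    have [|j] := tz (M.+1%:R^-1); first by rewrite invr_gt0.
    rewrite az add0r ltf_pV2 ?posrE // ltr_nat ltnS ltnNge; case/negP.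
    case: ltnP => // jN.
    exact: (@leq_bigmax _ (fun j : 'I_N => c j) (Ordinal jN)).
  exists (fun j => if (j < N)%N then c j else j); first by move=> j ->.
  rewrite (target_sigma_diag _ Kx); apply/asboolPn => h; apply: h => d d0.
  have [k kd] : exists k : nat, d^-1 < k%:R.
    by exists (Num.truncn d^-1).+1; exact: truncnS_gt.
  exists (maxn N k); rewrite az add0r ltnNge leq_maxl /=.
  rewrite invf_plt ?posrE // (lt_le_trans kd) // ler_nat.
  by rewrite ltnW // ltnS leq_maxr.
move=> c; have [v [Gv /bit_cvgP[N hN]]] := GP (a c, K).
exists N => n /hN <-; have := Gv n => /=.
by move=> <-; congr (ga_fun (G _) _); exact/val_inj.
Qed.

Lemma SCI_sigma_diag : window J -> SCI_G (P_sigma_diag r) = Some 2.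
Proof.
move=> K; apply: SCI_G_eqS; first exact: sigma_diag_tower2.
exact: sigma_diag_no_tower1.
Qed.

End DiagonalHeight.

(** * The minimal degree *)

Theorem corollary4p1 (R : realType) (J : set R)
    (J_interval : is_interval J) (J_compact : compact J)
    (J_interior : J° !=set0)
    (eps : R) (eps_gt0 : 0 < eps)
    (r : approx_window J)
    (G : countable_graph)
    (code : {fset G} -> nat) (code_inj : injective code) :
  let U := six_problems eps r code in
  min_degrees 2 U = (fun X => X = raw_class 2 U (P_sigma_diag r)) /\
  (fun X => X = raw_class 2 U (P_sigma_diag r)) =
    (fun X => X = raw_class 2 U (P_pseudo_diag eps r)).
Proof.
move=> U.
have K : window J.
  have [x /interior_subset Jx] := cid J_interior.
  by exists [set (x%:C)%C]; exists x.
have A0 : inst (P_sigma_diag r) by exact: (0, K).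
have sp := sigma_le_pseudo r eps_gt0 K.
split; last first.
  congr (fun Y X => X = Y); apply: raw_class_eq => //.
  by split=> //; exact: pseudo_le_sigma.
apply: min_degrees_least => //.
  by split; [left; constructor 1|exact: SCI_sigma_diag].
move=> Q [] [] ->.
- exact: raw_reducible_refl.
- exact: diag_le_gen.
- apply: diag_le_graph => // a.
  by rewrite !spectrum_mult_op thickening_vtx_inv.
- exact: sp.
- by apply: (raw_reducible_trans A0 sp); exact: diag_le_gen.
apply: (raw_reducible_trans A0 sp); apply: diag_le_graph => // a.
by rewrite !pseudospectrum_mult_op // thickening_vtx_inv.
Qed.
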